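(* Let $L\ge1$ be fixed, let $\mathcal{A}_1,\ldots,\mathcal{A}_L$ be classically independent subalgebras of $\mathcal{A}$, and for each $l\in[L]$ let $(a_k^{(l)})_{k\ge1}\subset\mathcal{A}_l$ be self-adjoint, free, identically distributed random variables with mean $\lambda$ and variance $\sigma^2$. Then $$S_n=\frac{1}{\sqrt n}\sum_{k\in[n]}\Big(\bigotimes_{l\in[L]}a_k^{(l)}-\lambda^L\Big)$$ converges in distribution, as $n\to\infty$, towards $\sum_{J\in\mathcal{P}^*(L)}\lambda^{|J^c|}\sigma^{|J|}s_J$, where the $s_J$, $J\in\mathcal{P}^*(L)$, are $h_L$-independent semi-circle random variables, $h_L$ being the graph with vertex set $\mathcal{P}^*(L)$ and edge set $$E(h_L)=\{(J_1,J_2)\in\mathcal{P}^*(L)^2:\ J_1\cap J_2=\varnothing\}.$$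
   Context: Notation: $[n]=\{1,\dots,n\}$. $(\mathcal{A},\tau)$ is a noncommutative probability space (a unital $*$-algebra with a state $\tau$). The mean of $a$ is $\tau(a)$, its variance is $\tau(a^2)-\tau(a)^2$. $\mathcal{P}^*(L)$ is the collection of nonempty subsets of $[L]$; $J^c=[L]\setminus J$. Classically independent subalgebras commute with each other. The tensor $\bigotimes_{l\in[L]}a_k^{(l)}$ is identified with the product $\prod_{l\in[L]}a_k^{(l)}$ of the classically independent (commuting) variables $a_k^{(1)},\dots,a_k^{(L)}$. $g$-independence: for a loopless graph $g$ with finite vertex set $V$ and edge set $E$, subalgebras $(\mathcal{A}_v)_{v\in V}$ are $g$-independent if (1) for every $(i,j)\in E$, $\mathcal{A}_i,\mathcal{A}_j$ are classically independent (in particular they commute); (2) for every $k\ge1$ and $i\in V^k$ such that for all $j_1<j_2$ with $i_{j_1}=i_{j_2}$ there exists $j_1<j_3<j_2$ with $(i_{j_1},i_{j_3})\notin E$, one has $\tau(a_1\cdots a_k)=0$ for all centered $a_j\in\mathcal{A}_{i_j}$, $j\in[k]$. Random variables are $g$-independent if the subalgebras they generate are. Convergence in distribution of self-adjoint $b_n$ to $z$ means $\tau(b_n^p)\to\tau(z^p)$ for every $p\in\mathbb{N}$ (the limit may live in another noncommutative probability space, whose state is also denoted $\tau$). Semi-circle random variables are self-adjoint and standard (mean $0$, variance $1$). *)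

(* Defs.v *)
From mathcomp Require Import all_boot all_order all_algebra complex.
From mathcomp Require Import all_classical all_reals all_analysis.
Import Order.TTheory GRing.Theory Num.Theory numFieldNormedType.Exports.

Set Implicit Arguments.
Unset Strict Implicit.
Unset Printing Implicit Defensive.

Local Open Scope classical_set_scope.
Local Open Scope complex_scope.
Local Open Scope ring_scope.

(* The order on R[i] is partial: 0 <= z says that z is real and nonnegative. *)
Record ncprob (R : realType) := NCProb {
  ncalg :> algType R[i];
  star : ncalg -> ncalg;
  state : {scalar ncalg};
  starK : involutive star;
  star_antilinear : forall (c : R[i]) (x y : ncalg),
    star (c *: x + y) = c^* *: star x + star y;
  starM : forall x y : ncalg, star (x * y) = star y * star x;
  state1 : state 1 = 1;
  state_ge0 : forall x : ncalg, 0 <= state (star x * x)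
}.

Arguments star {R _}.
Arguments state {R _}.

Section Independence.
Context (R : realType) (A : ncprob R).
Implicit Types (S : set A) (x : A).

Definition selfadjoint x : Prop := star x = x.
Definition centered x : Prop := state x = 0.
Definition nc_mean x : R[i] := state x.
Definition nc_variance x : R[i] := state (x ^+ 2) - state x ^+ 2.

Definition subalgebra S : Prop := GRing.subalg_closed (mem S).

Definition generated x : set A := smallest subalgebra [set x].

(* The order of the factors in the product is irrelevant, by commutation. *)
Definition classically_independent (I : finType) (S : I -> set A) : Prop :=
  (forall i j, i != j -> forall x y, S i x -> S j y -> x * y = y * x) /\
  (forall x : I -> A, (forall i, S i (x i)) ->
     state (\prod_i x i) = \prod_i state (x i)).

Definition freely_independent (I : Type) (S : I -> set A) : Prop :=
  forall (k : nat) (i : 'I_k -> I) (x : 'I_k -> A),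
    (0 < k)%N ->
    (forall j1 j2 : 'I_k, j2 = j1.+1 :> nat -> i j1 <> i j2) ->
    (forall j, S (i j) (x j) /\ centered (x j)) ->
    state (\prod_(j < k) x j) = 0.

Definition identically_distributed (I : Type) (x : I -> A) : Prop :=
  forall (i j : I) (p : nat), state (x i ^+ p) = state (x j ^+ p).

End Independence.

Record loopless_graph (V : finType) := LooplessGraph {
  edge : rel V;
  edge_sym : symmetric edge;
  edge_irr : irreflexive edge
}.

Definition g_independent (R : realType) (A : ncprob R) (V : finType)
    (g : loopless_graph V) (S : V -> set A) : Prop :=
  (forall v w, edge g v w ->
     classically_independent (fun b : bool => if b then S v else S w)) /\
  (forall (k : nat) (i : 'I_k -> V) (x : 'I_k -> A),
    (0 < k)%N ->
    (forall j1 j2 : 'I_k, (j1 < j2)%N -> i j1 = i j2 ->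
       exists j3 : 'I_k, (j1 < j3 < j2)%N /\ ~~ edge g (i j1) (i j3)) ->
    (forall j, S (i j) (x j) /\ centered (x j)) ->
    state (\prod_(j < k) x j) = 0).

(* The moments of the density sqrt (4 - t^2) / (2 pi) on [-2, 2]. *)
Definition semicircle_moment (R : realType) (p : nat) : R :=
  \int[lebesgue_measure]_(t in `[-2, 2])
    (t ^+ p * (Num.sqrt (4 - t ^+ 2) / (2 * pi))).

Definition semicircular (R : realType) (A : ncprob R) (s : A) : Prop :=
  selfadjoint s /\
  forall p : nat, state (s ^+ p) = (semicircle_moment R p)%:C.

Definition cvg_in_distribution (R : realType) (A B : ncprob R)
    (b : nat -> A) (z : B) : Prop :=
  forall p : nat,
    (fun n => (state (b n ^+ p) : R[i]^o)) @ \oo --> (state (z ^+ p) : R[i]^o).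

Notation Pstar L := {J : {set 'I_L} | J != finset.set0}.

Definition hL_edge (L : nat) : rel (Pstar L) :=
  fun J1 J2 => finset.setI (val J1) (val J2) == finset.set0.

Lemma hL_edge_sym (L : nat) : symmetric (@hL_edge L).
Proof. by move=> J1 J2; rewrite /hL_edge finset.setIC. Qed.

Lemma hL_edge_irr (L : nat) : irreflexive (@hL_edge L).
Proof. by move=> J; rewrite /hL_edge finset.setIid; apply/negbTE/(valP J). Qed.

Definition hL (L : nat) : loopless_graph (Pstar L) :=
  LooplessGraph (@hL_edge_sym L) (@hL_edge_irr L).

(* The sequence is indexed from 0; n = 0 gives 0. *)
Definition tensor_sum (R : realType) (A : ncprob R) (L : nat) (lam : R)
    (a : 'I_L -> nat -> A) (n : nat) : A :=
  ((Num.sqrt n%:R)^-1)%:C *: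
    \sum_(k < n) (\prod_(l < L) a l k - ((lam ^+ L)%:C)%:A).

(* Main.v *)
(* Expanding tensors in the centered variables c_k = a_k - lambda, the p-th
   moment of S_n becomes a sum over words of letters (J, k), with J a nonempty
   subset of [L] and k < n, of moments that depend only on which labels k
   coincide and that vanish when some label occurs once.  Summing out the
   letters one at a time, a letter whose label is neither fresh nor currently
   unpaired loses a factor sqrt n, so in the limit a letter either opens a pair
   or closes one.  By freeness, J can close a pair only if its partner carries
   the same J and commutes with everything opened since; this is a process of
   pushing and popping on heaps over h_L.  On the semicircular side the same
   process is multiplication by s_J in the basis of products of Chebyshev
   polynomials, s_J U_n(s_J) = U_(n+1)(s_J) + U_(n-1)(s_J), whose nontrivial
   members have mean zero by independence. *)
Require Import Defs.
From mathcomp Require Import all_boot all_order all_algebra complex.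
From mathcomp Require Import all_classical all_reals all_analysis.
From mathcomp Require Import ring lra.
Import Order.TTheory GRing.Theory Num.Theory numFieldNormedType.Exports.

Local Open Scope classical_set_scope.
Local Open Scope complex_scope.
Local Open Scope ring_scope.

Set Implicit Arguments.
Unset Strict Implicit.
Unset Printing Implicit Defensive.

(** * Subalgebras and polynomials in a single variable *)

Section Subalgebras.
Context (R : realType) (A : ncprob R).
Implicit Types (S : set A) (x y : A).

Lemma subalgebra1 S : subalgebra S -> S 1.
Proof. by case=> h _ _; rewrite inE in h. Qed.

Lemma subalgebraM S x y : subalgebra S -> S x -> S y -> S (x * y).
Proof.
by case=> _ _ h Sx Sy; have := h x y; rewrite !inE; apply.
Qed.

Lemma subalgebra_linear S (c : R[i]) x y :
  subalgebra S -> S x -> S y -> S (c *: x + y).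
Proof.
by case=> _ h _ Sx Sy; have := h c x y; rewrite !inE; apply.
Qed.

Lemma subalgebra0 S : subalgebra S -> S 0.
Proof.
move=> hS; rewrite -(addNr (1 : A)) -scaleN1r.
by apply: subalgebra_linear => //; exact: subalgebra1.
Qed.

Lemma subalgebraZ S (c : R[i]) x : subalgebra S -> S x -> S (c *: x).
Proof.
move=> hS Sx; rewrite -[c *: x]addr0; apply: subalgebra_linear => //.
exact: subalgebra0.
Qed.

Lemma subalgebraB S x y : subalgebra S -> S x -> S y -> S (x - y).
Proof.
by move=> hS Sx Sy; rewrite addrC -scaleN1r; exact: subalgebra_linear.
Qed.

Lemma subalgebra_generated x : subalgebra (generated x).
Proof.
split.
- by rewrite inE => S [hS _]; exact: subalgebra1.
- move=> c u v; rewrite !inE => hu hv S hS; have [? ?] := hS.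
  by apply: subalgebra_linear => //; [exact: hu|exact: hv].
- move=> u v; rewrite !inE => hu hv S hS; have [? ?] := hS.
  by apply: subalgebraM => //; [exact: hu|exact: hv].
Qed.

Lemma generated_self x : generated x x.
Proof. by move=> S [_]; exact. Qed.

Lemma subalgebra_horner S x (p : {poly R[i]}) :
  subalgebra S -> S x -> S (horner_alg x p).
Proof.
move=> hS Sx; elim/poly_ind: p => [|p c ih].
  by rewrite raddf0; exact: subalgebra0.
rewrite rmorphD rmorphM /= horner_algC horner_algX addrC.
apply: subalgebra_linear; [exact: hS|exact: subalgebra1|].
exact: subalgebraM.
Qed.

End Subalgebras.

(** * Words in a free family and their reduction to alternating centered words *)

Section FreeFamily.
Context (R : realType) (A : ncprob R) (I : eqType) (a : I -> A).
Hypothesis a_free : freely_independent (fun k => generated (a k)).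
Local Notation C := R[i].
Local Notation word := (seq (I * {poly C})).
Implicit Types (s u v w : word).

(** A letter [(k, p)] stands for the polynomial [p] in [a k]. Keeping polynomials formal makes
    merging and centering operations on words. *)
Definition word_eval s : A := \prod_(x <- s) horner_alg (a x.1) x.2.

Definition poly_mean (k : I) (p : {poly C}) : C := state (horner_alg (a k) p).

Definition centered_word s := all (fun x => poly_mean x.1 x.2 == 0) s.

Definition alternating s := sorted (fun x y : I * {poly C} => x.1 != y.1) s.

Lemma word_eval_cat u v : word_eval (u ++ v) = word_eval u * word_eval v.
Proof. by rewrite /word_eval big_cat. Qed.

Lemma word_eval_cons x v :
  word_eval (x :: v) = horner_alg (a x.1) x.2 * word_eval v.
Proof. by rewrite /word_eval big_cons. Qed.

Lemma word_eval_merge u k p q v :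
  word_eval (u ++ (k, p) :: (k, q) :: v) = word_eval (u ++ (k, p * q) :: v).
Proof. by rewrite !word_eval_cat !word_eval_cons /= rmorphM /= !mulrA. Qed.

Lemma word_eval_split u k p c v :
  word_eval (u ++ (k, p + c%:P) :: v) =
  word_eval (u ++ (k, p) :: v) + c *: word_eval (u ++ v).
Proof.
rewrite !word_eval_cat !word_eval_cons /= raddfD /= horner_algC.
by rewrite mulrDl mulrDr -scalerAl mul1r scalerAr.
Qed.

Lemma poly_mean_center k p : poly_mean k (p - (poly_mean k p)%:P) = 0.
Proof.
rewrite /poly_mean raddfB /= horner_algC raddfB /= scalarZ state1 mulr1.
by rewrite subrr.
Qed.

Lemma state_alternating s : s != [::] -> centered_word s -> alternating s ->
  state (word_eval s) = 0.
Proof.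
case: s => // x0 s _; set w := x0 :: s => cw aw.
have -> : word_eval w = \prod_(j < size w)
    horner_alg (a (nth x0 w j).1) (nth x0 w j).2.
  by rewrite /word_eval (big_nth x0) big_mkord.
apply: (a_free (i := fun j : 'I_(size w) => (nth x0 w j).1)) => //.
- move=> j1 j2 j21; apply/eqP; rewrite j21.
  by have /(sortedP x0) := aw; move/(_ j1); apply; rewrite -j21.
- move=> j; split.
    apply: (@subalgebra_horner _ _ (generated _)).
      exact: subalgebra_generated.
    exact: generated_self.
  by apply/eqP; move/allP : cw; apply; exact: mem_nth.
Qed.

(* The elimination argument behind every computation with free variables:
   merging neighbours and splitting off means reduces any word to
   alternating centered words. *)
Lemma word_functional_eq0 (D : pred I) (H : word -> C) :
  (forall u k p q v,
    H (u ++ (k, p) :: (k, q) :: v) = H (u ++ (k, p * q) :: v)) ->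
  (forall u k p c v,
    H (u ++ (k, p + c%:P) :: v) = H (u ++ (k, p) :: v) + c * H (u ++ v)) ->
  (forall s, centered_word s -> alternating s ->
    all (fun x => D x.1) s -> H s = 0) ->
  forall s, all (fun x => D x.1) s -> H s = 0.
Proof.
move=> Hmerge Hsplit H0 s; have [n] := ubnP (size s).
elim: n s => // n ih s.
(* [w] is the part already centered and alternating, [v] the part still to be treated; the outer
   induction is on the total length, the inner one on [v]. *)
suff key w v : centered_word w -> alternating w -> (size (w ++ v) < n.+1)%N ->
    all (fun x => D x.1) (w ++ v) -> H (w ++ v) = 0.
  by move=> sn sD; apply: (key [::]).
elim: v w => [|[k p] v ihv] w cw aw swv wvD.
  by rewrite cats0 in wvD *; exact: H0.
have -> : p = p - (poly_mean k p)%:P + (poly_mean k p)%:P by rewrite subrK.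
rewrite Hsplit.
have -> : H (w ++ v) = 0.
  apply: ih; first by move: swv; rewrite !size_cat /= addnS ltnS.
  by move: wvD; rewrite !all_cat /= => /and3P[-> _ ->].
rewrite mulr0 addr0; set q := p - _.
have cq : poly_mean k q == 0 by rewrite /q poly_mean_center.
case: (lastP w) cw aw swv wvD => [|w' [k' p']] cw aw swv wvD.
  by apply: (ihv [:: (k, q)]) => //; rewrite /centered_word /= cq.
(* Equal neighbouring labels merge, which shortens the word; distinct ones let the new centered
   letter join [w]. *)
have [kk'|kk'] := eqVneq k' k.
  rewrite kk' cat_rcons Hmerge; apply: ih.
    by move: swv; rewrite !size_cat size_rcons /= addSn addnS ltnS.
  by move: wvD; rewrite !all_cat /= all_rcons /= -andbA => /and4P[_ -> -> ->].
rewrite -cat_rcons; apply: ihv.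
- by rewrite /centered_word all_rcons /= cq.
- case: w' {cw swv wvD} aw => [|x w']; first by rewrite /alternating /= kk'.
  rewrite /alternating /= => aw.
  by rewrite rcons_path aw last_rcons /= kk'.
- by move: swv; rewrite !size_cat !size_rcons /= !addSn !addnS.
- by move: wvD; rewrite !cat_rcons !all_cat.
Qed.

(** Reducing [u] and [v] never produces a letter labelled [o], so the block, which begins and ends
    with [o], stays alternating with its neighbours, and freeness kills every resulting word. *)
Lemma state_centered_block o x m u v :
  centered_word (x :: m) -> alternating (x :: m) ->
  x.1 = o -> (last x m).1 = o ->
  all (fun y => y.1 != o) u -> all (fun y => y.1 != o) v ->
  state (word_eval (u ++ (x :: m) ++ v)) = 0.
Proof.
move=> cm am xo mo uo vo; pose D : pred I := fun k => k != o.
have base w : centered_word w -> alternating w -> all (fun y => D y.1) w ->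
    forall w', all (fun y => D y.1) w' ->
    state (word_eval (w ++ (x :: m) ++ w')) = 0.
  move=> cw aw wo; apply: word_functional_eq0.
  - by move=> s k p q s'; rewrite !catA word_eval_merge.
  - move=> s k p c s'.
    by rewrite !catA word_eval_split raddfD /= scalarZ.
  - move=> s cs as_ so; apply: state_alternating.
    + by case: (w).
    + by rewrite /centered_word !all_cat; apply/and3P.
    + have amw : alternating ((x :: m) ++ s).
        case: s {cs} as_ so => [|y s] as_ so; first by rewrite cats0.
        move: am as_; rewrite /alternating /= cat_path /= => -> ->.
        by case/andP: so => so _; rewrite mo eq_sym andbT.
      case: w cw aw wo => [|y w] _ aw wo //.
      rewrite /alternating /= in aw amw *.
      rewrite [path _ y _]cat_path /= aw amw andbT xo; move/allP : wo; apply; exact: mem_last.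
pose H w := state (word_eval (w ++ (x :: m) ++ v)).
apply: (@word_functional_eq0 D H _ _ _ u) => //.
- by move=> s k p q s'; rewrite /H -!catA !cat_cons word_eval_merge.
- move=> s k p c s'.
  by rewrite /H -!catA !cat_cons word_eval_split raddfD /= scalarZ.
- by move=> s cs as_ so; exact: base.
Qed.

(** The difference of the two sides respects merging and splitting. On alternating centered words it
    vanishes: identical distribution preserves means and injectivity keeps neighbouring labels
    distinct. *)
Lemma state_word_relabel (f : I -> I) s : identically_distributed a ->
  injective f -> state (word_eval [seq (f x.1, x.2) | x <- s]) =
  state (word_eval s).
Proof.
move=> aid finj; set F := fun x : I * {poly C} => (f x.1, x.2).
have mean_eq k k' p : poly_mean k p = poly_mean k' p.
  rewrite /poly_mean -[p]coefK poly_def !raddf_sum /=.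
  apply: eq_bigr => j _; rewrite !linearZ /= !rmorphXn /= !horner_algX.
  by rewrite -!scalerAl !mul1r !scalarZ (aid k k').
apply/eqP; rewrite -subr_eq0; apply/eqP.
pose H w := state (word_eval (map F w)) - state (word_eval w).
apply: (@word_functional_eq0 predT H) => //; last exact: all_predT.
- by move=> u k p q v; rewrite /H !map_cat /= !word_eval_merge.
- move=> u k p c v; rewrite /H !map_cat /= !word_eval_split !raddfD /=.
  by rewrite !scalarZ mulrBr addrACA.
- case=> [|x w] cw aw _; first by rewrite /H subrr.
  rewrite /H !state_alternating ?subrr //.
  + rewrite /centered_word all_map; apply: sub_all cw => y /=.
    by rewrite (mean_eq (f y.1) y.1).
  + rewrite /alternating sorted_map; apply: sub_sorted aw => y z /=.
    by rewrite (inj_eq finj).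
Qed.

End FreeFamily.

(** * Asymptotics of moments that depend only on coincidences of labels *)

Section Asymptotics.
Context (R : realType).
Local Notation C := R[i].

Definition rsqrt (n : nat) : C := ((Num.sqrt n%:R)^-1)%:C.
Definition csqrt (n : nat) : C := (Num.sqrt n%:R)%:C.

Lemma rsqrtK n : (0 < n)%N -> rsqrt n * csqrt n = 1.
Proof.
move=> n0; rewrite /rsqrt /csqrt -rmorphM mulVf //.
by rewrite sqrtr_eq0 -ltNge ltr0n.
Qed.

Lemma natr_rsqrt2 n : (0 < n)%N -> n%:R * rsqrt n ^+ 2 = 1.
Proof.
move=> n0; have -> : (n%:R : C) = csqrt n ^+ 2.
  by rewrite -rmorphXn /= sqr_sqrtr ?ler0n // rmorph_nat.
by rewrite -exprMn mulrC rsqrtK // expr1n.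
Qed.

Lemma cvg_rsqrt : (rsqrt n : C^o) @[n --> \oo] --> (0 : C^o).
Proof.
have cR : ((Num.sqrt n%:R)^-1 : R) @[n --> \oo] --> (0 : R).
  apply/cvgrPdist_lt => e e0; near=> n; rewrite sub0r normrN.
  rewrite ger0_norm ?invr_ge0 ?sqrtr_ge0 //.
  rewrite invf_plt ?posrE ?sqrtr_gt0 ?ltr0n //; last by near: n; exact: nbhs_infty_gt.
  have -> : e^-1 = Num.sqrt (e^-1 ^+ 2).
    by rewrite sqrtr_sqr ger0_norm ?invr_ge0 ?ltW.
  rewrite ltr_sqrt.
    by near: n; exact: nbhs_infty_gtr.
  by rewrite ltr0n; near: n; exact: nbhs_infty_gt.
apply/cvgrPdist_lt => e e0.
(* A positive element of [R[i]] is real, so real convergence is enough. *)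
have [r r0 ->] : exists2 r : R, 0 < r & e = r%:C.
  case: e e0 => x y; rewrite ltcE /= => /andP[/eqP -> x0].
  by exists x.
have h : \forall n \near \oo, `|0 - (Num.sqrt n%:R)^-1| < r.
  by move/cvgrPdist_lt : cR; apply.
apply: filterS h => n; rewrite !sub0r !normrN => h.
by rewrite /rsqrt normc_def /= expr0n addr0 sqrtr_sqr ltcR.
Unshelve. all: by end_near. Qed.

Lemma cvg_sumC (S : Type) (r : seq S) (f : S -> nat -> C^o) (l : S -> C^o) :
  (forall i, f i n @[n --> \oo] --> l i) ->
  \sum_(i <- r) f i n @[n --> \oo] --> \sum_(i <- r) l i.
Proof.
move=> h; apply: cvg_big => //; exact: add_continuous.
Qed.

Context (T : finType) (b : T -> C) (G : seq (T * nat) -> C).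
Local Notation word := (seq (T * nat)).
Implicit Types (u v : word).

Definition labels u := map snd u.

Definition relabel (f : nat -> nat) u : word := [seq (x.1, f x.2) | x <- u].

Definition open_labels u :=
  [seq k <- undup (labels u) | count_mem k (labels u) == 1%N].

(** Absent labels are already excluded, so [!= 1] means at least two occurrences. *)
Definition closed_labels u :=
  [seq k <- undup (labels u) | count_mem k (labels u) != 1%N].

Definition fresh u := (\max_(k <- labels u) k).+1.

Hypothesis G_relabel : forall f u, injective f -> G (relabel f u) = G u.
Hypothesis G_open : forall u, open_labels u != [::] -> G u = 0.

(** Letters are prepended: [p] counts those still to be chosen to the left of [u]. The normalization
    [rsqrt n ^+ p] is kept outside. *)
Fixpoint partial_moment (n p : nat) u : C :=
  if p is p'.+1 then
    \sum_J b J * \sum_(k < n) partial_moment n p' ((J, val k) :: u)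
  else G u.

(** Two kinds of letters survive the limit: one with a new label, whose choices all agree, and one
    repeating an open label. *)
Fixpoint limit_moment (p : nat) u : C :=
  if p is p'.+1 then
    \sum_J b J * (limit_moment p' ((J, fresh u) :: u) +
      \sum_(k <- open_labels u) limit_moment p' ((J, k) :: u))
  else G u.

Lemma fresh_notin u k : (fresh u <= k)%N -> k \notin labels u.
Proof.
move=> uk; apply/negP => ku; move: uk; rewrite /fresh ltnNge => /negP; apply.
exact: leq_bigmax_seq.
Qed.

Lemma partial_moment_relabel n p (f : nat -> nat) u : injective f ->
  (forall k, (k < n)%N -> (f k < n)%N) ->
  partial_moment n p (relabel f u) = partial_moment n p u.
Proof.
move=> finj fn; elim: p u => [|p ih] u /=; first exact: G_relabel.
apply: eq_bigr => J _; congr (_ * _).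
pose h (k : 'I_n) := Ordinal (fn k (ltn_ord k)).
have hinj : injective h by move=> k k' /(congr1 val) /= /finj /val_inj.
rewrite (reindex_inj hinj) /=; apply: eq_bigr => k _.
by rewrite -[RHS]ih.
Qed.

(** The transposition of [k] and [k'] permutes the indices below [n] and fixes the labels of [u]. *)
Lemma partial_moment_fresh n p J u k k' :
  k \notin labels u -> k' \notin labels u -> (k < n)%N -> (k' < n)%N ->
  partial_moment n p ((J, k) :: u) = partial_moment n p ((J, k') :: u).
Proof.
move=> ku k'u kn k'n.
pose f i := if i == k then k' else if i == k' then k else i.
have fK : involutive f.
  move=> i; rewrite /f; have [->|ik] := eqVneq i k.
    by have [//|] := eqVneq k' k; rewrite eqxx.
  have [->|ik'] := eqVneq i k'; first by rewrite eqxx.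
  by rewrite (negbTE ik) (negbTE ik').
rewrite -(@partial_moment_relabel n p f ((J, k) :: u)).
- congr partial_moment; rewrite /relabel /= {1}/f eqxx; congr (_ :: _).
  rewrite -[RHS]map_id; apply/eq_in_map => -[K i] iu /=; rewrite /f.
  have iu' : i \in labels u by apply/mapP; exists (K, i).
  case: eqVneq => [ik|_]; first by rewrite -ik iu' in ku.
  by case: eqVneq => [ik|_] //; rewrite -ik iu' in k'u.
- exact: inv_inj.
- by move=> i; rewrite /f; case: ifP => // _; case: ifP.
Qed.

Lemma sum_labels_split n p J u : (fresh u < n)%N ->
  \sum_(k < n) partial_moment n p ((J, val k) :: u) =
  (n%:R - (size (undup (labels u)))%:R) * partial_moment n p ((J, fresh u) :: u)
  + \sum_(k <- open_labels u) partial_moment n p ((J, k) :: u)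
  + \sum_(k <- closed_labels u) partial_moment n p ((J, k) :: u).
Proof.
move=> un; pose F k := partial_moment n p ((J, k) :: u).
have used (H : nat -> C) : \sum_(0 <= k < n | k \in labels u) H k =
    \sum_(k <- undup (labels u)) H k.
  rewrite -big_filter; apply: perm_big; apply: uniq_perm.
  - exact/filter_uniq/iota_uniq.
  - exact: undup_uniq.
  - move=> k; rewrite mem_filter mem_undup mem_index_iota /=.
    case: (boolP (k \in labels u)) => //= ku.
    rewrite (leq_ltn_trans _ un) // leqNgt; apply/negP => uk.
    by move: ku; apply/negP/fresh_notin/ltnW.
have unused : \sum_(0 <= k < n | k \notin labels u) F k =
    (n%:R - (size (undup (labels u)))%:R) * F (fresh u).
  transitivity (\sum_(0 <= k < n | k \notin labels u) F (fresh u)).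
    rewrite !big_mkord; apply: eq_bigr => k ku.
    by apply: partial_moment_fresh => //; exact: fresh_notin.
  have split : \sum_(0 <= k < n) F (fresh u) =
      \sum_(0 <= k < n | k \in labels u) F (fresh u) +
      \sum_(0 <= k < n | k \notin labels u) F (fresh u).
    by rewrite (bigID (mem (labels u))).
  apply: (addrI (\sum_(0 <= k < n | k \in labels u) F (fresh u))).
  rewrite -split.
  rewrite used !big_const_seq !count_predT size_iota subn0 !iter_addr_0.
  by rewrite mulrBl !mulr_natl addrC subrK.
rewrite -(big_mkord xpredT F) (bigID (mem (labels u))) /= used unused addrC.
rewrite -addrA; congr (_ + _).
rewrite /open_labels /closed_labels !big_filter.
exact: (bigID (fun k => count_mem k (labels u) == 1%N)).
Qed.

Lemma count_labels_cons J k u i :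
  count_mem i (labels ((J, k) :: u)) = ((k == i) + count_mem i (labels u))%N.
Proof. by []. Qed.

Lemma mem_open_labels u i :
  (i \in open_labels u) = (count_mem i (labels u) == 1%N).
Proof.
rewrite mem_filter mem_undup; case: eqP => //= h.
by rewrite -has_pred1 has_count h.
Qed.

Lemma mem_closed_labels u i :
  (i \in closed_labels u) = (1 < count_mem i (labels u))%N.
Proof.
rewrite mem_filter mem_undup -has_pred1 has_count.
by case: (count_mem i (labels u)) => [|[|]].
Qed.

Lemma uniq_open_labels u : uniq (open_labels u).
Proof. exact/filter_uniq/undup_uniq. Qed.

Lemma open_labels_fresh J k u : k \notin labels u ->
  perm_eq (open_labels ((J, k) :: u)) (k :: open_labels u).
Proof.
move=> ku; have k0 : count_mem k (labels u) = 0%N by apply/count_memPn.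
apply: uniq_perm; rewrite /= ?uniq_open_labels ?mem_open_labels ?k0 //.
move=> i; rewrite inE !mem_open_labels count_labels_cons [i == k]eq_sym.
by case: (eqVneq k i) => [<-|//]; rewrite k0.
Qed.

Lemma open_labels_open J k u : k \in open_labels u ->
  perm_eq (open_labels u) (k :: open_labels ((J, k) :: u)).
Proof.
rewrite mem_open_labels => /eqP k1.
apply: uniq_perm; rewrite /= ?uniq_open_labels ?mem_open_labels ?count_labels_cons ?k1 ?eqxx //.
move=> i; rewrite inE !mem_open_labels count_labels_cons [i == k]eq_sym.
by case: (eqVneq k i) => [<-|//]; rewrite k1.
Qed.

Lemma open_labels_closed J k u : k \in closed_labels u ->
  perm_eq (open_labels ((J, k) :: u)) (open_labels u).
Proof.
rewrite mem_closed_labels => k1.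
apply: uniq_perm; rewrite ?uniq_open_labels //.
move=> i; rewrite !mem_open_labels count_labels_cons.
by case: (eqVneq k i) => [<-|//]; case: (count_mem k _) k1 => [|[|]].
Qed.

Lemma eventually_cvg (f g : nat -> C^o) (l : C^o) N :
  (forall n, (N < n)%N -> f n = g n) ->
  f n @[n --> \oo] --> l -> g n @[n --> \oo] --> l.
Proof.
move=> fg; apply: cvg_trans; apply: near_eq_cvg.
by near=> n; apply: fg; near: n; exact: nbhs_infty_gt.
Unshelve. all: by end_near. Qed.

(* A label occurring once costs a factor sqrt n, since it has to be repeated
   by the remaining letters. *)
Theorem cvg_partial_moment p u :
  (rsqrt n ^+ p * csqrt n ^+ size (open_labels u) * partial_moment n p u : C^o)
    @[n --> \oo] --> (limit_moment p u : C^o).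
Proof.
elim: p u => [|p ih] u /=.
  (* With no letter left, [G u] can be nonzero only if nothing is open, and then the power of
     [csqrt n] is 1. *)
  have [open0|open0] := eqVneq (open_labels u) [::].
    apply: (@eventually_cvg (fun=> G u) _ _ 0); last exact: cvg_cst.
    by move=> n _; rewrite open0 !expr0 !mul1r.
  apply: (@eventually_cvg (fun=> G u) _ _ 0); last exact: cvg_cst.
  by move=> n _; rewrite (G_open open0) mulr0.
set o := size (open_labels u).
have -> : (fun n => rsqrt n ^+ p.+1 * csqrt n ^+ o *
      \sum_J b J * \sum_(k < n) partial_moment n p ((J, val k) :: u)) =
    (fun n => \sum_J b J * (rsqrt n ^+ p.+1 * csqrt n ^+ o *
      \sum_(k < n) partial_moment n p ((J, val k) :: u))).
  apply/funext => n; rewrite mulr_sumr; apply: eq_bigr => J _.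
  by rewrite mulrCA.
apply: cvg_sumC => J.
apply: (@cvgM _ _ _ _ (fun=> b J)); first exact: cvg_cst.
pose W n k := partial_moment n p ((J, k) :: u).
(* With [d] labels in use, a new one offers [n - d] choices and adds an open label; since
   [n * rsqrt n ^+ 2 = 1], the surplus factor is [1 - d * rsqrt n ^+ 2], which tends to 1. *)
have cvg_fresh : (rsqrt n ^+ p.+1 * csqrt n ^+ o *
    ((n%:R - (size (undup (labels u)))%:R) * W n (fresh u)) : C^o)
    @[n --> \oo] --> (limit_moment p ((J, fresh u) :: u) : C^o).
  have := ih ((J, fresh u) :: u).
  rewrite (perm_size (open_labels_fresh J (fresh_notin (leqnn _)))) /= -/o => h.
  rewrite -[limit_moment _ _]mul1r.
  have h1 : ((1 - (size (undup (labels u)))%:R * (rsqrt n * rsqrt n)) : C^o)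
      @[n --> \oo] --> (1 - (size (undup (labels u)))%:R * (0 * 0) : C^o).
    apply: cvgB; first exact: (@cvg_cst C^o).
    apply: (@cvgM C); first exact: (@cvg_cst C^o).
    by apply: (@cvgM C); exact: cvg_rsqrt.
  rewrite !mulr0 subr0 in h1.
  have h2 := @cvgM C nat \oo _ _ _ _ _ h1 h.
  apply: (@eventually_cvg _ _ _ 0 _ (h2 _)) => n n0.
  rewrite /GRing.mul_fun /= -{1}(natr_rsqrt2 n0) -/(W n (fresh u)) expr2 -mulrBl.
  set w := W _ _; set d := _ - _.
  rewrite [csqrt n ^+ o.+1]exprS [rsqrt n ^+ p.+1]exprS.
  have := rsqrtK n0; set r := rsqrt n; set c := csqrt n => rc.
  transitivity ((r * c) * (r * d * r ^+ p * c ^+ o * w)); first by ring.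
  by rewrite rc; ring.
(* Closing a label lowers the power of [csqrt n] by one, which exactly absorbs the extra
   [rsqrt n]. *)
have cvg_open : \sum_(k <- open_labels u) (rsqrt n ^+ p.+1 * csqrt n ^+ o * W n k : C^o)
    @[n --> \oo] --> (\sum_(k <- open_labels u) limit_moment p ((J, k) :: u) : C^o).
  rewrite big_seq; under eq_fun do rewrite big_seq.
  apply: cvg_big; [exact: add_continuous|] => k ku.
  have := ih ((J, k) :: u).
  apply: (@eventually_cvg _ _ _ 0) => n n0.
  rewrite /o (perm_size (open_labels_open J ku)) /= !exprS.
  rewrite -/(W n k); set r := rsqrt n; set c := csqrt n.
  transitivity ((r * c) * (r ^+ p * c ^+ size (open_labels ((J, k) :: u)) * W n k)).
    by rewrite rsqrtK // mul1r.
  by ring.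
(* A label already closed leaves the open labels unchanged, so one factor [rsqrt n] is left over and
   kills the term. *)
have cvg_closed : \sum_(k <- closed_labels u) (rsqrt n ^+ p.+1 * csqrt n ^+ o * W n k : C^o)
    @[n --> \oo] --> (0 : C^o).
  have h k : k \in closed_labels u ->
      (rsqrt n ^+ p.+1 * csqrt n ^+ o * W n k : C^o) @[n --> \oo] --> (0 : C^o).
    move=> ku; have := @cvgM C nat \oo _ _ _ _ _ (@cvg_rsqrt) (ih ((J, k) :: u)).
    rewrite mul0r => h; apply: (@eventually_cvg _ _ _ 0 _ (h _)) => n _ /=.
    by rewrite (perm_size (open_labels_closed J ku)) [rsqrt n ^+ p.+1]exprS !mulrA.
  have : \sum_(k <- closed_labels u | k \in closed_labels u)
      (rsqrt n ^+ p.+1 * csqrt n ^+ o * W n k : C^o) @[n --> \oo] -->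
      (\sum_(k <- closed_labels u | k \in closed_labels u) 0 : C^o).
    by apply: cvg_big; [exact: add_continuous|exact: h].
  rewrite big1; last by [].
  by apply: (@eventually_cvg _ _ _ 0) => n _; rewrite [RHS]big_seq.
have hs : (rsqrt n ^+ p.+1 * csqrt n ^+ o *
      ((n%:R - (size (undup (labels u)))%:R) * W n (fresh u)) +
    \sum_(k <- open_labels u) rsqrt n ^+ p.+1 * csqrt n ^+ o * W n k +
    \sum_(k <- closed_labels u) rsqrt n ^+ p.+1 * csqrt n ^+ o * W n k : C^o)
    @[n --> \oo] --> (limit_moment p ((J, fresh u) :: u) +
      \sum_(k <- open_labels u) limit_moment p ((J, k) :: u) + 0 : C^o).
  exact: cvgD (cvgD cvg_fresh cvg_open) cvg_closed.
rewrite addr0 in hs; apply: (@eventually_cvg _ _ _ (fresh u) _ hs) => n un.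
by rewrite (sum_labels_split _ _ un) !mulrDr !mulr_sumr.
Unshelve. all: by end_near. Qed.

End Asymptotics.

(** * Chebyshev polynomials of the second kind *)

Section Chebyshev.

(* The pair (U_n, U_(n-1)), with U_(-1) = 0. *)
Definition chebyshev_pair (V : pzRingType) (x : V) (n : nat) : V * V :=
  iter n (fun u => (x * u.1 - u.2, u.1)) (1, 0).

(* U_n(x/2) for the Chebyshev polynomials of the second kind. *)
Definition chebyshev (V : pzRingType) (x : V) (n : nat) : V :=
  (chebyshev_pair x n).1.

Lemma chebyshev0 (V : pzRingType) (x : V) : chebyshev x 0 = 1.
Proof. by []. Qed.

Lemma chebyshev1 (V : pzRingType) (x : V) : chebyshev x 1 = x.
Proof. by rewrite /chebyshev /= mulr1 subr0. Qed.

Lemma chebyshevSS (V : pzRingType) (x : V) n :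
  chebyshev x n.+2 = x * chebyshev x n.+1 - chebyshev x n.
Proof. by []. Qed.

Lemma rmorph_chebyshev (V W : pzRingType) (f : {rmorphism V -> W}) (x : V) n :
  f (chebyshev x n) = chebyshev (f x) n.
Proof.
suff h m : f (chebyshev_pair x m).1 = (chebyshev_pair (f x) m).1 /\
    f (chebyshev_pair x m).2 = (chebyshev_pair (f x) m).2 by have [] := h n.
elim: m => [|m [ih1 ih2]] /=; first by rewrite rmorph1 rmorph0.
by rewrite rmorphB rmorphM ih1 ih2.
Qed.

(** These first-order relations turn integration by parts into a recurrence for integrals. They are
    proved together because [U_(n+1)] involves both [U_n] and [U_(n-1)]. *)
Lemma deriv_chebyshev_pair (R : comNzRingType) (n : nat) :
  let u := chebyshev_pair ('X : {poly R}) n in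
  ('X^2 - 4) * u.1^`() = n%:R * 'X * u.1 - 2 * n.+1%:R * u.2 /\
  ('X^2 - 4) * u.2^`() = 2 * n%:R * u.1 - n.+1%:R * 'X * u.2.
Proof.
elim: n => [|n []] /=.
  have -> : (1 : {poly R})^`() = 0 by rewrite -polyC1 derivC.
  by rewrite (linear0 deriv); split; ring.
set u := (chebyshev_pair _ n).1; set v := (chebyshev_pair _ n).2 => ih1 ih2.
split; last by rewrite ih1 -![_.+1%:R]natr1; ring.
rewrite derivB derivM derivX mul1r.
transitivity (('X^2 - 4) * u + 'X * (('X^2 - 4) * u^`()) - ('X^2 - 4) * v^`());
  first by ring.
by rewrite ih1 ih2 -![_.+1%:R]natr1; ring.
Qed.

End Chebyshev.

(** * Integrals of Chebyshev polynomials against the semicircle law *)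

Section Semicircle.
Context (R : realType).
Implicit Types P : {poly R}.

Definition semicircle_density (t : R) : R := Num.sqrt (4 - t ^+ 2) / (2 * pi).

Definition semicircle_int P : R :=
  \int[lebesgue_measure]_(t in `[-2, 2]) (P.[t] * semicircle_density t).

Lemma continuous_sqrt_poly P : continuous (fun t : R => Num.sqrt P.[t]).
Proof.
move=> t; apply: (@continuous_comp _ _ _ (horner P) Num.sqrt).
  exact: continuous_horner.
exact: sqrt_continuous.
Qed.

Lemma horner_4subX2 (t : R) : (4 - 'X^2).[t] = 4 - t ^+ 2.
Proof. by rewrite hornerD hornerN hornerXn hornerMn -polyC1 hornerC. Qed.

Lemma continuous_semicircle_integrand P :
  continuous (fun t : R => P.[t] * semicircle_density t).
Proof.
have -> : (fun t : R => P.[t] * semicircle_density t) =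
    (fun t : R => P.[t] * (Num.sqrt (4 - 'X^2).[t] / (2 * pi))).
  by apply/funext => t; rewrite horner_4subX2.
move=> t; apply: cvgM; first exact: continuous_horner.
by apply: cvgM; [exact: continuous_sqrt_poly|exact: cvg_cst].
Qed.

Lemma integrable_semicircle P : lebesgue_measure.-integrable `[-2, 2]
  (EFin \o (fun t : R => P.[t] * semicircle_density t)).
Proof.
apply: continuous_compact_integrable; first exact: segment_compact.
exact/continuous_subspaceT/continuous_semicircle_integrand.
Qed.

Lemma semicircle_int_linear (c : R) P Q :
  semicircle_int (c *: P + Q) = c * semicircle_int P + semicircle_int Q.
Proof.
rewrite /semicircle_int -RintegralZl //; last exact: integrable_semicircle.
rewrite -RintegralD //; last exact: integrable_semicircle.
  by apply: eq_Rintegral => t _; rewrite hornerD hornerZ mulrDl -mulrA.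
have := integrable_semicircle (c *: P); congr (_.-integrable _ _).
by apply/funext => t /=; rewrite hornerZ -mulrA.
Qed.

Lemma semicircle_int0 : semicircle_int 0 = 0.
Proof.
have := semicircle_int_linear 1 0 0.
by rewrite scaler0 addr0 mul1r => /eqP; rewrite -subr_eq subrr eq_sym => /eqP.
Qed.

Lemma semicircle_intXn n : semicircle_int 'X^n = semicircle_moment R n.
Proof. by apply: eq_Rintegral => t _; rewrite hornerXn. Qed.

(* Integration by parts: the integrand is (P(t) (4 - t^2)^(3/2))' / (2 pi). *)
Lemma semicircle_int_parts P :
  semicircle_int ((4 - 'X^2) * P^`() - 3 * 'X * P) = 0.
Proof.
pose Q : {poly R} := 4 - 'X^2.
pose F (t : R) := (P * Q).[t] * Num.sqrt Q.[t] / (2 * pi).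
have F0 (t : R) : t ^+ 2 = 4 -> F t = 0.
  by move=> t4; rewrite /F hornerM horner_4subX2 t4 subrr mulr0 !mul0r.
have cF : continuous F.
  move=> t; apply: cvgM; last exact: cvg_cst.
  apply: cvgM; [exact: continuous_horner|exact: continuous_sqrt_poly].
(* Inside the interval [4 - t^2] is positive and the square root is differentiable; at the endpoints
   continuity of [F] is enough. *)
have dF (t : R) : t \in `]-2, 2[ ->
    is_derive t 1 F (((Q * P^`() - 3 * 'X * P).[t]) * semicircle_density t).
  rewrite in_itv /= => /andP[t1 t2].
  have Q0 : 0 < Q.[t] by rewrite horner_4subX2; nra.
  have dS : is_derive t (1 : R) (Num.sqrt \o horner Q)
      ((2 * Num.sqrt Q.[t])^-1 * Q^`().[t]).
    exact: (is_derive1_comp (is_derive1_sqrt Q0)).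
  have dG : is_derive t (1 : R)
      ((2 * pi)^-1 \*: (horner (P * Q) * (Num.sqrt \o horner Q)))
      ((2 * pi)^-1 *: ((P * Q).[t] *: ((2 * Num.sqrt Q.[t])^-1 * Q^`().[t]) +
        Num.sqrt Q.[t] *: (P * Q)^`().[t])).
    exact: is_deriveZ (is_deriveM _ _).
  have -> : F = (2 * pi)^-1 \*: (horner (P * Q) * (Num.sqrt \o horner Q)).
    by apply/funext => x; rewrite /F mulrC.
  apply: is_derive_eq dG _.
  have dQ : Q^`().[t] = - (2 * t).
    rewrite /Q derivB derivXn hornerD hornerN hornerMn hornerXn expr1.
    by rewrite derivMn -polyC1 derivC mul0rn horner0 mulr_natl sub0r.
  rewrite /semicircle_density -horner_4subX2 -/Q; clearbody Q.
  rewrite -mulrA [3 * _]mulr_natl derivM hornerD [(_ + _).[t]]hornerD hornerN hornerMn.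
  rewrite !hornerM dQ hornerX.
  set S := Num.sqrt _; have S0 : S != 0 by rewrite sqrtr_eq0 -ltNge.
  have -> : Q.[t] = S ^+ 2 by rewrite sqr_sqrtr // ltW.
  have : 2 * pi != 0 :> R by rewrite mulf_neq0 // lt0r_neq0 // pi_gt0.
  move: (2 * pi) => c c0; rewrite /GRing.scale /=.
  by field; rewrite c0 S0.
rewrite /semicircle_int /Rintegral.
rewrite (@continuous_FTC2 _ _ F) //.
- by rewrite !F0 ?subee //; [rewrite sqrrN| ]; rewrite expr2; lra.
- exact: gtrN.
- exact/continuous_subspaceT/continuous_semicircle_integrand.
- split.
  + by move=> t /dF [].
  + exact/cvg_at_right_filter/cF.
  + exact/cvg_at_left_filter/cF.
- by move=> t /dF [_ h]; rewrite derive1E.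
Qed.

(** Writing [I] for the integral, parts applied to [U_m] gives
    [(m+3) I(U_(m+1)) = (m-1) I(U_(m-1))]. From [U_(-1) = 0] this settles odd indices; the factor
    [m-1] vanishes at [m = 1], which starts the even ones. *)
Lemma semicircle_int_chebyshev n : semicircle_int (chebyshev 'X n.+1) = 0.
Proof.
have rec m : m.+3%:R * semicircle_int (chebyshev_pair 'X m.+1).1 =
    (m%:R - 1) * semicircle_int (chebyshev_pair 'X m).2.
  have := semicircle_int_parts (chebyshev_pair 'X m).1.
  have [h _] := @deriv_chebyshev_pair R m.
  set u := (chebyshev_pair _ m).1 in h *; set v := (chebyshev_pair _ m).2 in h *.
  have -> : (4 - 'X^2) * u^`() - 3 * 'X * u =
      (- m.+3%:R) *: (chebyshev_pair 'X m.+1).1 + ((m%:R - 1) *: v + 0).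
    transitivity (- (('X^2 - 4) * u^`()) - 3 * 'X * u); first by ring.
    rewrite h /= -/u -/v -!mul_polyC !rmorphN !rmorphB /= !polyCMn.
    rewrite -![_.+3%:R]natr1; ring.
  rewrite !semicircle_int_linear semicircle_int0 addr0 mulNr addrC => /eqP.
  by rewrite subr_eq0 => /eqP.
have m3 m : (m.+3%:R : R) != 0 by rewrite pnatr_eq0.
(* The factor [n%:R] in the second claim allows for [U_0 = 1], whose integral is not zero; it is the
   coefficient that [rec] supplies. *)
suff [] : semicircle_int (chebyshev 'X n.+1) = 0 /\
    n%:R * semicircle_int (chebyshev 'X n) = 0 by [].
elim: n => [|n [ih1 ih2]].
  split; last by rewrite mul0r.
  by apply: (mulfI (m3 0)); rewrite (rec 0) /= semicircle_int0 !mulr0.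
split; last by rewrite ih1 mulr0.
apply: (mulfI (m3 n.+1)); rewrite mulr0 -ih2 (rec n.+1).
by rewrite -natr1 addrK.
Qed.

End Semicircle.

(** * Stacks of letters up to the commutations of a graph *)

Section GraphStack.
Context (V : finType) (g : loopless_graph V).
Implicit Types (J K : V) (m r : seq V).

(* Letters joined by an edge commute.  Inserting J as deep as possible keeps equal
   letters that commutations could bring together adjacent, see reduced. *)
Fixpoint push J m :=
  if m is K :: m' then
    if edge g J K then K :: push J m' else J :: m
  else [:: J].

(** Succeeds when commutations can bring an occurrence of [J] to the front. As [g] is loopless, the
    search stops at the first [J]. *)
Fixpoint pop J m : option (seq V) :=
  if m is K :: m' then
    if edge g J K then omap (cons K) (pop J m')
    else if K == J then Some m' else None
  else None.

Fixpoint reduced m :=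
  if m is K :: m' then
    reduced m' && ((ohead m' == Some K) || (pop K m' == None))
  else true.

(** The search for [K] walks past any letter adjacent to [K], so inserting such a letter, or
    removing one as in [pop_pop_None], cannot make it succeed. *)
Lemma pop_push_None J K m :
  edge g K J -> pop K m = None -> pop K (push J m) = None.
Proof.
move=> KJ; elim: m => [|X m ih] /=; first by rewrite KJ.
case: (boolP (edge g J X)) => JX /=.
  case: (edge g K X); last by case: eqP.
  by case: pop ih => //= ih _; rewrite ih.
by rewrite KJ /= => h; rewrite h.
Qed.

Lemma pop_pop_None J K m r :
  edge g K J -> pop K m = None -> pop J m = Some r -> pop K r = None.
Proof.
move=> KJ; elim: m r => [|X m ih] r //=.
case: (boolP (edge g J X)) => JX /=.
  case: (pop J m) ih => //= r' ih h [<-] /=.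
  case: (edge g K X) h; last by case: eqP.
  by case: (pop K m) ih => //= /(_ r') ih _; rewrite ih.
case: (X =P J) => [->|//]; rewrite KJ => h [<-].
by case: pop h.
Qed.

Lemma reduced_push J m : reduced m -> reduced (push J m).
Proof.
elim: m => [|K m ih] //= /andP[rm h].
case: (boolP (edge g J K)) => JK /=; last first.
  rewrite rm h /=; case: (eqVneq K J) => [->|KJ]; first by rewrite eqxx.
  by rewrite (negbTE JK) orbT.
rewrite ih //=; case/orP: h => [h|/eqP h].
  case: m {ih rm} h => // X m /eqP[XK].
  by rewrite XK /= JK /= eqxx.
by rewrite pop_push_None ?orbT // edge_sym.
Qed.

Lemma reduced_pop J m r : reduced m -> pop J m = Some r -> reduced r.
Proof.
elim: m r => [|K m ih] r //= /andP[rm h].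
case: (boolP (edge g J K)) => JK /=; last by case: eqP => // _ [<-].
case E: (pop J m) => [r'|] //= [<-] /=.
rewrite ih //=; case/orP: h => [h|/eqP h].
  case: m {ih rm} h E => // X m /eqP[->]; rewrite /= JK.
  by case: pop => //= y [<-]; rewrite eqxx.
by rewrite (pop_pop_None _ h E) ?orbT // edge_sym.
Qed.

Lemma reduced_catr l m : reduced (l ++ m) -> reduced m.
Proof. by elim: l => //= K l ih /andP[/ih]. Qed.

(** The form taken by a reduced stack once each run is collapsed to one letter; [separatedP]
    extracts from it the index condition of g-independence. *)
Fixpoint separated m :=
  if m is K :: m' then separated m' && (pop K m' == None) else true.

Lemma pop_None_blocked J m i : pop J m = None -> (i < size m)%N ->
  nth J m i = J -> exists2 k, (k < i)%N & ~~ edge g J (nth J m k).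
Proof.
elim: m i => [|K m ih] //= i; case: (boolP (edge g J K)) => JK; last first.
  case: eqVneq => // KJ _; case: i => [|i] im /= h; last by exists 0%N.
  by rewrite h eqxx in KJ.
case E: (pop J m) => // _; case: i => [|i] im /= h.
  by rewrite h edge_irr in JK.
by have [k ki kJ] := ih i E im h; exists k.+1.
Qed.

Lemma separatedP x0 m i j : separated m -> (i < j)%N -> (j < size m)%N ->
  nth x0 m i = nth x0 m j ->
  exists2 k, (i < k < j)%N & ~~ edge g (nth x0 m i) (nth x0 m k).
Proof.
elim: m i j => [|K m ih] //= i [|j] //= /andP[sm /eqP pK].
case: i => [|i] ij jm /= h.
  have [|k kj] := pop_None_blocked pK jm.
    by rewrite (set_nth_default x0).
  rewrite (set_nth_default x0) ?(ltn_trans kj) // => hk.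
  by exists k.+1.
by have [k ik hk] := ih i j sm ij jm h; exists k.+1.
Qed.

Lemma head_block m : m != [::] -> exists K n r,
  m = nseq n.+1 K ++ r /\ ohead r != Some K.
Proof.
elim: m => // K [|K' m] ih _; first by exists K, 0%N, [::].
have [//|X [n [r [-> hr]]]] := ih.
have [->|KX] := eqVneq K X; first by exists X, n.+1, r.
exists K, 0%N, (nseq n.+1 X ++ r); split=> //=.
by apply: contra_neq KX => -[].
Qed.

(** The length of a run does not affect whether the search fails, so runs may be collapsed. *)
Lemma pop_block_None K X n r :
  pop K (nseq n.+1 X ++ r) = None -> pop K (X :: r) = None.
Proof.
elim: n => [|n ih] // h; apply: ih; move: h => /=.
case: (boolP (edge g K X)) => KX; first by case: pop.
by case: eqP.
Qed.

End GraphStack.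

(** * Products of Chebyshev polynomials in the semicircular variables *)

Section WickProducts.
Context (R : realType) (B : ncprob R) (V : finType) (g : loopless_graph V).
Context (s : V -> B).
Hypothesis s_semicircular : forall J, semicircular (s J).
Hypothesis s_independent : g_independent g (fun J => generated (s J)).
Implicit Types (J K : V) (m r : seq V).

Lemma semicircular_comm J K : edge g J K -> s J * s K = s K * s J.
Proof.
move=> JK; have [[h _] _] := (s_independent.1 _ _ JK, tt).
by apply: (h true false) => //; exact: generated_self.
Qed.

Lemma chebyshev_horner_alg (x : B) n :
  chebyshev x n = horner_alg x (map_poly (real_complex R) (chebyshev 'X n)).
Proof. by rewrite !rmorph_chebyshev /= map_polyX horner_algX. Qed.

Lemma state_semicircular_poly J (P : {poly R}) :
  state (horner_alg (s J) (map_poly (real_complex R) P)) = (semicircle_int P)%:C.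
Proof.
rewrite -[P]coefK poly_def.
elim/big_ind: _ => [|P1 P2 h1 h2|i _].
- by rewrite !raddf0 /= semicircle_int0.
- have := @semicircle_int_linear R 1 P1 P2; rewrite scale1r mul1r => ->.
  by rewrite !raddfD /= h1 h2.
- have := @semicircle_int_linear R P`_i 'X^i 0.
  rewrite semicircle_int0 !addr0 semicircle_intXn => ->.
  rewrite map_polyZ /= map_polyXn linearZ /= rmorphXn /= horner_algX.
  by rewrite -scalerAl mul1r scalarZ (s_semicircular J).2 rmorphM.
Qed.

Lemma state_chebyshev J n : (0 < n)%N -> state (chebyshev (s J) n) = 0.
Proof.
case: n => // n _; rewrite chebyshev_horner_alg state_semicircular_poly.
by rewrite semicircle_int_chebyshev.
Qed.

(* A run of n letters K contributes the factor U_n(s_K), see wick_block. *)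
Fixpoint wick m : B :=
  if m is K :: m' then
    s K * wick m' -
      (if m' is K' :: m'' then if K' == K then wick m'' else 0 else 0)
  else 1.

Lemma wick_cons K m : ohead m != Some K -> wick (K :: m) = s K * wick m.
Proof.
case: m => [|X m] /=; first by rewrite subr0.
by case: (eqVneq X K) => [->|XK _]; rewrite ?eqxx // subr0.
Qed.

Lemma wick_cons2 K m : wick (K :: K :: m) = s K * wick (K :: m) - wick m.
Proof. by rewrite [LHS]/= eqxx. Qed.

(** The variable [s J] slides past the letters that commute with [J]; at the first one that does
    not, it either opens a new run or meets a run of [J], where the Chebyshev recurrence applies. *)
Lemma mul_wick J m : reduced g m ->
  s J * wick m = wick (push g J m) + oapp wick 0 (pop g J m).
Proof.
have [n] := ubnP (size m); elim: n m => // n ih [|K m] mn rm.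
  by rewrite /= subr0 addr0.
case: (boolP (edge g J K)) => JK; last first.
  have -> : push g J (K :: m) = [:: J, K & m] by rewrite /= (negbTE JK).
  have -> : pop g J (K :: m) = if K == J then Some m else None.
    by rewrite /= (negbTE JK).
  case: (eqVneq K J) => [->|KJ]; first by rewrite wick_cons2 subrK.
  by rewrite addr0 [RHS]wick_cons //=; apply: contra_neq KJ => -[].
have JneK : J != K by apply: contraTneq JK => ->; rewrite edge_irr.
have rm' : reduced g m by case/andP: rm.
have ihm := ih m mn rm'.
(* Inside a run of [K] the recursion of [wick] has two terms, so induction is needed for two shorter
   stacks. *)
have [hK|hK] := eqVneq (ohead m) (Some K).
  case: m hK mn rm rm' ihm => // X m [->] mn rm rm' ihm.
  have ihm2 : s J * wick m = wick (push g J m) + oapp wick 0 (pop g J m).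
    by apply: ih; [exact: ltnW|case/andP: rm'].
  rewrite wick_cons2 mulrBr mulrA (semicircular_comm JK) -mulrA ihm ihm2.
  have -> : push g J [:: K, K & m] = [:: K, K & push g J m] by rewrite /= JK.
  have -> : push g J (K :: m) = K :: push g J m by rewrite /= JK.
  have -> : pop g J [:: K, K & m] = omap (fun r => [:: K, K & r]) (pop g J m).
    by rewrite /= JK; case: pop.
  have -> : pop g J (K :: m) = omap (cons K) (pop g J m) by rewrite /= JK.
  rewrite wick_cons2 mulrDr opprD addrACA; congr (_ + _).
  case: pop => [r|]; first exact/esym/wick_cons2.
  by rewrite [oapp _ _ _]/= mulr0 subr0.
rewrite (wick_cons hK) mulrA (semicircular_comm JK) -mulrA ihm mulrDr.
have -> : push g J (K :: m) = K :: push g J m by rewrite /= JK.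
have -> : pop g J (K :: m) = omap (cons K) (pop g J m) by rewrite /= JK.
congr (_ + _).
  rewrite wick_cons //; case: m hK {ihm rm rm' mn} => [|X m] /= hK.
    by apply: contra_neq JneK => -[].
  by case: (edge g J X) => //=; apply: contra_neq JneK => -[].
case: m hK {ihm mn} rm rm' => [|X m] hK rm rm'; first exact: mulr0.
have hXK : X != K by apply: contra_neq hK => ->.
rewrite /=; case: (boolP (edge g J X)) => JX.
  case: pop => [r|]; last exact: mulr0.
  by apply/esym/wick_cons; apply: contra_neq hXK => -[].
case: (eqVneq X J) => [XJ|_]; last exact: mulr0.
(* If [K] headed what is left after removing [J], it could have been brought next to the first [K],
   against reducedness. *)
apply/esym/wick_cons; case/andP: rm => _ /orP[/eqP[h]|/eqP].
  by rewrite h eqxx in hXK.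
rewrite XJ /= edge_sym JK; case E: (pop g K m) => // _.
by apply: contra_eq_neq E; case: m {rm' hK} => //= Y m [->]; rewrite edge_irr eqxx.
Qed.

Lemma wick_block K n r : ohead r != Some K ->
  wick (nseq n K ++ r) = chebyshev (s K) n * wick r.
Proof.
move=> hr; suff [] : wick (nseq n K ++ r) = chebyshev (s K) n * wick r /\
    wick (nseq n.+1 K ++ r) = chebyshev (s K) n.+1 * wick r by [].
elim: n => [|n [ih1 ih2]].
  by rewrite chebyshev0 chebyshev1 mul1r; split=> //; exact: wick_cons.
split=> //; rewrite chebyshevSS mulrBl -mulrA -ih1 -ih2.
exact: wick_cons2.
Qed.

(** Each run becomes one factor of positive degree. The clause on [pop] is carried along so that, in
    the induction, the letter of the first run is known to be blocked from its later copies. *)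
Lemma wick_blocks m : reduced g m -> exists b : seq (V * nat),
  [/\ wick m = \prod_(x <- b) chebyshev (s x.1) x.2,
      all (fun x => 0 < x.2)%N b, (b == [::]) = (m == [::]),
      (forall K, pop g K m = None -> pop g K (map fst b) = None) &
      separated g (map fst b)].
Proof.
have [n] := ubnP (size m); elim: n m => // n ih m mn rm.
have [->|m0] := eqVneq m [::].
  by exists [::]; split=> //=; rewrite big_nil.
have [K [k [r [em hr]]]] := head_block m0.
have rr : reduced g (K :: r).
  have em' : m = nseq k K ++ K :: r by rewrite em -addn1 nseqD -catA.
  by apply: (@reduced_catr _ g (nseq k K)); rewrite -em'.
have [|b [eb pb b0 popb sb]] := ih r _ (andP rr).1.
  rewrite ltnS in mn; apply: leq_trans mn.
  by rewrite em size_cat size_nseq addSn ltnS leq_addl.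
exists ((K, k.+1) :: b); split=> //=.
- by rewrite big_cons -eb em wick_block.
- move=> X; rewrite em => /pop_block_None /=.
  case: (edge g X K); last by case: eqP.
  by case E: (pop g X r) => // _; rewrite popb.
- rewrite sb /= popb //; case/andP: rr => _; rewrite (negbTE hr) /=.
  by move/eqP.
Qed.

(** Chebyshev polynomials of positive degree integrate to zero, so the factors are centered, and
    their letters are separated, as g-independence requires. *)
Lemma state_wick m : reduced g m -> m != [::] -> state (wick m) = 0.
Proof.
move=> rm m0; have [b [-> pb b0 _ sb]] := wick_blocks rm.
case: b pb b0 sb => [|x0 b']; first by rewrite (negbTE m0).
set b := x0 :: b' => pb _ sb.
rewrite (big_nth x0) big_mkord.
apply: (s_independent.2 _ (fun j : 'I_(size b) => (nth x0 b j).1)) => //.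
- move=> j1 j2 j12 e12.
  have nthE (j : nat) : (j < size b)%N -> (nth x0 b j).1 = nth x0.1 (map fst b) j.
    by move=> jb; rewrite (nth_map x0).
  have jm : (j2 < size (map fst b))%N by rewrite size_map.
  have h : nth x0.1 (map fst b) j1 = nth x0.1 (map fst b) j2 by rewrite -!nthE.
  have [k /andP[k1 k2] hk] := separatedP sb j12 jm h.
  have kb : (k < size b)%N by apply: ltn_trans k2 _.
  exists (Ordinal kb); split; first by rewrite /= k1 k2.
  by rewrite !nthE.
- move=> j; split.
    rewrite chebyshev_horner_alg.
    apply: (@subalgebra_horner _ _ (generated _)).
      exact: subalgebra_generated.
    exact: generated_self.
  by apply: state_chebyshev; move/allP : pb; apply; exact: mem_nth.
Qed.

End WickProducts.

(** * Stacks of labelled letters *)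

Section LabelledStack.
Context (V : finType) (g : loopless_graph V).
Local Notation word := (seq (V * nat)).
Implicit Types (J K : V) (m r : word).

Fixpoint lpush J k m : word :=
  if m is x :: m' then
    if edge g J x.1 then x :: lpush J k m' else (J, k) :: m
  else [:: (J, k)].

(** The label to close is prescribed: the search fails if the first [J] it reaches carries another
    label. *)
Fixpoint lpop J o m : option word :=
  if m is x :: m' then
    if edge g J x.1 then omap (cons x) (lpop J o m')
    else if (x.1 == J) && (x.2 == o) then Some m' else None
  else None.

Lemma map_fst_lpush J k m : map fst (lpush J k m) = push g J (map fst m).
Proof. by elim: m => //= x m ih; case: ifP => // _; rewrite /= ih. Qed.

Lemma perm_lpush J k m : perm_eq (lpush J k m) ((J, k) :: m).
Proof.
elim: m => //= x m ih; case: ifP => // _ /=.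
rewrite -(perm_cons x) in ih; apply: perm_trans ih _.
exact: permEl (perm_catCA [:: x] [:: (J, k)] _).
Qed.

Lemma perm_labels_lpush J k m :
  perm_eq (labels (lpush J k m)) (k :: labels m).
Proof. exact: perm_map (perm_lpush J k m). Qed.

Lemma lpop_pop J o m r :
  lpop J o m = Some r -> pop g J (map fst m) = Some (map fst r).
Proof.
elim: m r => [|x m ih] r //=; case: ifP => _.
  by case: lpop ih => //= r' /(_ _ erefl) -> [<-].
by case: ifP => // /andP[-> _] [<-].
Qed.

Lemma lpop_Some J o m r : lpop J o m = Some r -> exists m1 m2,
  [/\ m = m1 ++ (J, o) :: m2, r = m1 ++ m2 & all (fun x => edge g J x.1) m1].
Proof.
elim: m r => [|x m ih] r //=; case: ifP => [Jx|_].
  case E: lpop => [r'|] //= [<-].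
  have [m1 [m2 [-> -> m1J]]] := ih _ E.
  by exists (x :: m1), m2; rewrite /= Jx.
case: x => K k /=; case: ifP => // /andP[/eqP -> /eqP ->] [<-].
by exists [::], m.
Qed.

Lemma lpop_cat J o m1 m2 : all (fun x => edge g J x.1) m1 ->
  lpop J o (m1 ++ (J, o) :: m2) = Some (m1 ++ m2).
Proof.
elim: m1 => [|x m1 ih] /=; first by rewrite edge_irr !eqxx.
by case/andP=> -> /ih ->.
Qed.

Lemma pop_lpop J m : uniq (labels m) ->
  if pop g J (map fst m) is Some l then
    exists2 o, o \in labels m &
      (exists2 r, lpop J o m = Some r & l = map fst r) /\
      forall o', o' != o -> lpop J o' m = None
  else forall o, lpop J o m = None.
Proof.
elim: m => [|x m ih] //= /andP[xm um].
case: ifP => Jx.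
  case: pop (ih um) => [l|h] /=; last by move=> o; rewrite h.
  case=> o om [[r ro ->] h]; exists o; first by rewrite inE om orbT.
  split; first by exists (x :: r); rewrite ?ro.
  by move=> o' /h ->.
case: eqP => [_|_] //=; exists x.2; first by rewrite inE eqxx.
split; first by exists m; rewrite ?eqxx.
by move=> o' o'x; rewrite eq_sym (negbTE o'x).
Qed.

(** The search reaches at most one letter [J] and labels are distinct, so at most one label can be
    closed. *)
Lemma big_pop (W : nmodType) (F : seq V -> W) J m : uniq (labels m) ->
  \sum_(o <- labels m) (if lpop J o m is Some r then F (map fst r) else 0) =
  (if pop g J (map fst m) is Some l then F l else 0).
Proof.
move=> um; have := pop_lpop J um.
case: pop => [l|h]; last by rewrite big1 // => o _; rewrite h.
case=> o om [[r ro ->] h]; rewrite (bigD1_seq o) //= ro big1 ?addr0 //.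
by move=> o' /h ->.
Qed.

End LabelledStack.

(** * The limit moments as moments of the semicircular sum *)

Section LimitEvaluation.
Context (R : realType) (B : ncprob R) (V : finType) (g : loopless_graph V).
Context (s : V -> B).
Hypothesis s_semicircular : forall J, semicircular (s J).
Hypothesis s_independent : g_independent g (fun J => generated (s J)).
Local Notation C := R[i].
Local Notation word := (seq (V * nat)).
Context (coef wt : V -> C) (G : word -> C).
Hypothesis G_nil : G [::] = 1.
Hypothesis G_open : forall u, open_labels u != [::] -> G u = 0.
Hypothesis G_lpush : forall v J k m, G (v ++ (J, k) :: m) = G (v ++ lpush g J k m).
Hypothesis G_lpop : forall v J o m, uniq (labels m) -> o \in labels m ->
  o \notin labels v ->
  G (v ++ (J, o) :: m) =
    if lpop g J o m is Some r then wt J ^+ 2 * G (v ++ r) else 0.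

Definition avoids (v : word) (ks : seq nat) := all (fun k => k \notin labels v) ks.

(** The recursion prepends only fresh or open labels, so it stays among the extensions on which [G]
    vanishes. *)
Lemma limit_moment_eq0 p u : (forall v, avoids v (closed_labels u) -> G (v ++ u) = 0) ->
  limit_moment coef G p u = 0.
Proof.
elim: p u => [|p ih] u h /=; first by apply: (h [::]); apply/allP.
have sub J k : k \notin closed_labels u ->
    limit_moment coef G p ((J, k) :: u) = 0.
  move=> ku; apply: ih => v /allP hv; rewrite -cat_rcons; apply: h.
  apply/allP => i iu; rewrite /labels map_rcons mem_rcons inE negb_or.
  apply/andP; split; first by apply: contraNneq ku => /= <-.
  apply: hv; move: iu; rewrite !mem_closed_labels count_labels_cons.
  by move=> /leq_trans; apply; exact: leq_addl.
rewrite big1 // => J _; rewrite sub ?add0r ?big_seq ?big1 ?mulr0 //.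
  move=> k; rewrite mem_open_labels => /eqP k1.
  by apply: sub; rewrite mem_closed_labels k1.
rewrite mem_closed_labels -leqNgt.
have /count_memPn -> // : fresh u \notin labels u by exact: fresh_notin.
Qed.

(** Invariant: under extensions avoiding closed labels, [u] acts as [c] times the stack [m] of its
    open letters. Each step gains one weight: opening [J] adds [wt J] to the product over the stack,
    closing multiplies [c] by [wt J ^+ 2] and removes one [wt J] from the product. *)
Lemma limit_moment_wick p u m c :
  uniq (labels m) -> reduced g (map fst m) ->
  perm_eq (open_labels u) (labels m) ->
  (forall v, avoids v (closed_labels u) -> G (v ++ u) = c * G (v ++ m)) ->
  limit_moment coef G p u = c * \prod_(x <- m) wt x.1 *
    state ((\sum_J (coef J * wt J) *: s J) ^+ p * wick s (map fst m)).
Proof.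
set z := \sum_J _.
elim: p u m c => [|p ih] u m c um rm oum h /=.
  rewrite expr0 mul1r; have := h [::]; rewrite /= => ->; last by apply/allP.
  (* Up to [c], an empty stack contributes 1 to both sides and a nonempty one 0. *)
  case: m um rm oum {h} => [|x m] um rm oum.
    by rewrite big_nil /= state1 G_nil !mulr1.
  rewrite (state_wick s_semicircular s_independent rm) // mulr0 G_open ?mulr0 //.
  have : open_labels (x :: m) =i labels (x :: m).
    by move=> k; rewrite mem_open_labels count_uniq_mem //; case: (k \in _).
  by move=> /(_ x.2); rewrite inE eqxx /=; case: open_labels.
(* The rightmost factor of [z ^+ p.+1] acts on the stack by pushing and popping. *)
have -> : state (z ^+ p.+1 * wick s (map fst m)) =
    \sum_J coef J * wt J * (state (z ^+ p * wick s (push g J (map fst m))) +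
      (if pop g J (map fst m) is Some l then state (z ^+ p * wick s l) else 0)).
  have -> : z ^+ p.+1 * wick s (map fst m) =
      \sum_J (coef J * wt J) *: (z ^+ p * (s J * wick s (map fst m))).
    rewrite exprSr -mulrA {2}/z mulr_suml mulr_sumr; apply: eq_bigr => J _.
    by rewrite -scalerAl; exact/esym/scalerAr.
  rewrite raddf_sum /=; apply: eq_bigr => J _.
  rewrite scalarZ (mul_wick s_independent) // mulrDr raddfD /=.
  by congr (_ * (_ + _)); case: pop => //=; rewrite mulr0 raddf0.
rewrite mulr_sumr; apply: eq_bigr => J _.
have notin k : k \in open_labels u -> k \notin closed_labels u.
  by rewrite mem_open_labels mem_closed_labels => /eqP ->.
have closed_sub k v : avoids v (closed_labels ((J, k) :: u)) ->
    avoids v (closed_labels u).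
  move=> /allP hv; apply/allP => i iu; apply: hv; move: iu.
  rewrite !mem_closed_labels count_labels_cons.
  by move=> /leq_trans; apply; exact: leq_addl.
have avoids_rcons k v : k \notin closed_labels u ->
    avoids v (closed_labels u) -> avoids (rcons v (J, k)) (closed_labels u).
  move=> ku /allP hv; apply/allP => i iu.
  rewrite /labels map_rcons mem_rcons inE negb_or hv // andbT.
  by apply: contraNneq ku => /= <-.
have fu : fresh u \notin labels u by exact: fresh_notin.
have labels_m k : (k \in labels m) = (k \in open_labels u).
  by rewrite (perm_mem oum).
have fm : fresh u \notin labels m.
  rewrite labels_m mem_open_labels.
  by have /count_memPn -> := fu.
have eq_fresh : limit_moment coef G p ((J, fresh u) :: u) =
    c * \prod_(x <- m) wt x.1 *
      (wt J * state (z ^+ p * wick s (push g J (map fst m)))).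
  rewrite (ih _ (lpush g J (fresh u) m) c).
  - rewrite map_fst_lpush !mulrA; congr (_ * _).
    rewrite -!mulrA; congr (_ * _).
    by rewrite (perm_big _ (perm_lpush g J (fresh u) m)) big_cons mulrC.
  - by rewrite (perm_uniq (perm_labels_lpush _ _ _ _)) /= fm.
  - by rewrite map_fst_lpush; exact: reduced_push.
  - apply: (perm_trans (open_labels_fresh J fu)).
    by rewrite perm_sym (perm_trans (perm_labels_lpush _ _ _ _)) // perm_cons perm_sym.
  - move=> v hv; rewrite -G_lpush -!cat_rcons; apply: h.
    apply: avoids_rcons (closed_sub _ _ hv).
    rewrite mem_closed_labels -leqNgt.
    by have /count_memPn -> := fu.
have eq_open : \sum_(k <- open_labels u) limit_moment coef G p ((J, k) :: u) =
    c * \prod_(x <- m) wt x.1 * (wt J *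
    (if pop g J (map fst m) is Some l then state (z ^+ p * wick s l) else 0)).
  rewrite (perm_big _ oum) /=.
  rewrite -(big_pop g (fun l => state (z ^+ p * wick s l)) J um) !mulr_sumr.
  rewrite big_seq [RHS]big_seq; apply: eq_bigr => k km.
  have ku : k \in open_labels u by rewrite -labels_m.
  have hk v : avoids v (closed_labels ((J, k) :: u)) ->
      G (v ++ (J, k) :: u) =
      c * (if lpop g J k m is Some r then wt J ^+ 2 * G (v ++ r) else 0).
    move=> hv; rewrite -cat_rcons h.
      rewrite cat_rcons G_lpop //; move/allP : hv; apply.
      rewrite mem_closed_labels count_labels_cons eqxx.
      by move: ku; rewrite mem_open_labels => /eqP ->.
    by apply: avoids_rcons (notin _ ku) (closed_sub _ _ hv).
  case E: (lpop g J k m) hk => [r|] hk; last first.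
    (* When label [k] cannot be reached, all admissible extensions vanish as well, hence so does the
       whole recursion. *)
    by rewrite !mulr0; apply: limit_moment_eq0 => v /hk ->; rewrite mulr0.
  have [m1 [m2 [em er _]]] := lpop_Some E.
  have pm : perm_eq m ((J, k) :: r) by rewrite em er perm_catC /= perm_cons perm_catC.
  rewrite (ih _ r (c * wt J ^+ 2)).
  - by rewrite (perm_big _ pm) big_cons /=; ring.
  - by move: um; rewrite (perm_uniq (perm_map snd pm)) => /andP[].
  - exact: reduced_pop rm (lpop_pop E).
  - rewrite -(perm_cons k); have := open_labels_open J ku.
    rewrite perm_sym => /perm_trans; apply; apply: (perm_trans oum).
    exact: (perm_map snd pm).
  - by move=> v /hk ->; rewrite mulrA.
by rewrite eq_fresh eq_open -!mulrDr mulrCA !mulrA.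
Qed.

End LimitEvaluation.

Lemma prod_mul_comm (V : pzRingType) (I : eqType) (r : seq I) (x y : I -> V) :
  uniq r -> (forall i j, i != j -> x i * y j = y j * x i) ->
  (\prod_(i <- r) x i) * (\prod_(i <- r) y i) = \prod_(i <- r) (x i * y i).
Proof.
move=> ur xy; elim: r ur => [|i r ih] /=; first by rewrite !big_nil mulr1.
case/andP=> ir ur; rewrite !big_cons -ih // -!mulrA; congr (_ * _).
rewrite !mulrA; congr (_ * _).
elim: r ir {ih ur} => [|j r ih]; first by rewrite big_nil mul1r mulr1.
rewrite inE negb_or => /andP[ij ir].
by rewrite big_cons -mulrA ih // !mulrA xy // eq_sym.
Qed.

(** * Mixed moments of the centered variables of one free family *)

Section CenteredFreeFamily.
Context (R : realType) (A : ncprob R) (a : nat -> A) (lam : R[i]) (var : R[i]).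
Hypothesis a_free : freely_independent (fun k => generated (a k)).
Hypothesis a_mean : forall k, state (a k) = lam.
Hypothesis a_variance : forall k, nc_variance (a k) = var.
Implicit Types ks u v : seq nat.

Definition centering k : A := a k - lam%:A.

Definition centered_moment ks : R[i] := state (\prod_(k <- ks) centering k).

Local Notation cX := ('X - lam%:P).
Local Notation letters ks := [seq (k, cX) | k <- ks].

Lemma centered_moment_word ks :
  centered_moment ks = state (word_eval a (letters ks)).
Proof.
rewrite /centered_moment /word_eval big_map; congr (state _).
apply: eq_bigr => k _ /=.
by rewrite rmorphB /= horner_algX horner_algC.
Qed.

Lemma poly_mean_cX k : poly_mean a k cX = 0.
Proof.
rewrite /poly_mean rmorphB /= horner_algX horner_algC raddfB /= scalarZ.
by rewrite state1 a_mean mulr1 subrr.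
Qed.

Lemma poly_mean_cX2 k : poly_mean a k (cX * cX - var%:P) = 0.
Proof.
have -> : cX * cX - var%:P =
    'X^2 + (- (lam + lam))%:P * 'X + (lam * lam - var)%:P.
  by rewrite polyCN polyCB polyCD polyCM; ring.
rewrite /poly_mean !rmorphD !rmorphM /= horner_algX !horner_algC.
rewrite -!scalerAl !mul1r !raddfD /= !scalarZ state1 a_mean -(a_variance k).
by rewrite /nc_variance a_mean !expr2; ring.
Qed.

Lemma centered_moment_relabel (f : nat -> nat) ks : identically_distributed a ->
  injective f -> centered_moment (map f ks) = centered_moment ks.
Proof.
move=> aid finj; rewrite !centered_moment_word -[RHS](state_word_relabel a_free _ aid finj).
by rewrite -!map_comp.
Qed.

Lemma all_letters_neq o ks : o \notin ks ->
  all (fun y : nat * {poly R[i]} => y.1 != o) (letters ks).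
Proof.
move=> ok; rewrite all_map; apply/allP => k kk /=.
by apply: contraNneq ok => <-.
Qed.

Lemma centered_moment_single o u v : o \notin u -> o \notin v ->
  centered_moment (u ++ o :: v) = 0.
Proof.
move=> ou ov; rewrite centered_moment_word map_cat map_cons.
apply: (@state_centered_block _ _ _ _ a_free o (o, cX) [::]) => //.
- by rewrite /centered_word /= poly_mean_cX eqxx.
- exact: all_letters_neq.
- exact: all_letters_neq.
Qed.

(** The square of the centered variable is its variance plus a centered letter; the latter is a
    centered block on its own and contributes nothing. *)
Lemma centered_moment_pair o u v : o \notin u -> o \notin v ->
  centered_moment (u ++ o :: o :: v) = var * centered_moment (u ++ v).
Proof.
move=> ou ov; rewrite !centered_moment_word !map_cat !map_cons word_eval_merge.
rewrite -[cX * cX](subrK var%:P) word_eval_split raddfD /= scalarZ.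
rewrite [X in X + _](_ : _ = 0) ?add0r //.
apply: (@state_centered_block _ _ _ _ a_free o (o, _) [::]) => //.
- by rewrite /centered_word /= poly_mean_cX2 eqxx.
- exact: all_letters_neq.
- exact: all_letters_neq.
Qed.

(** As [y] is nonempty, has no repetition and does not contain [o], the segment from [o] to [o] is
    itself a centered alternating block. *)
Lemma centered_moment_cross o u y v : o \notin u -> o \notin y -> o \notin v ->
  uniq y -> y != [::] -> centered_moment (u ++ o :: y ++ o :: v) = 0.
Proof.
move=> ou oy ov uy y0.
have -> : u ++ o :: y ++ o :: v = u ++ (o :: rcons y o) ++ v.
  by rewrite /= cat_rcons.
rewrite centered_moment_word !map_cat map_cons.
apply: (@state_centered_block _ _ _ _ a_free o (o, cX) (letters (rcons y o))) => //.
- rewrite /centered_word /= poly_mean_cX eqxx /= all_map.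
  by apply/allP => k _ /=; rewrite poly_mean_cX.
- case: y y0 oy uy => // k y _; rewrite inE negb_or => /andP[ok oy] /= /andP[ky uy].
  rewrite /alternating /= ok /=.
  elim: y k ok oy ky uy => [|i y ih] k ok oy /= ky uy.
    by rewrite andbT eq_sym.
  move: ky oy; rewrite !inE !negb_or => /andP[-> _] /andP[oi oy] /=.
  by case/andP: uy => iy uy; exact: ih.
- by rewrite map_rcons last_rcons.
- exact: all_letters_neq.
- exact: all_letters_neq.
Qed.

End CenteredFreeFamily.

(** * Moments of words of tensors, computed coordinate by coordinate *)

Section TensorModel.
Context (R : realType) (A : ncprob R) (L : nat) (lam sigma : R).
Context (alg : 'I_L -> set A) (a : 'I_L -> nat -> A).
Hypothesis alg_subalgebra : forall l, subalgebra (alg l).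
Hypothesis alg_independent : classically_independent alg.
Hypothesis a_in_alg : forall l k, alg l (a l k).
Hypothesis a_free : forall l, freely_independent (fun k => generated (a l k)).
Hypothesis a_identical : forall l, identically_distributed (a l).
Hypothesis a_mean : forall l k, nc_mean (a l k) = lam%:C.
Hypothesis a_variance : forall l k, nc_variance (a l k) = (sigma ^+ 2)%:C.
Local Notation word := (seq (Pstar L * nat)).
Implicit Types (J K : Pstar L) (u v m : word).

Local Notation c l k := (centering (a l) lam%:C k).

Definition tensor_letter J k : A :=
  \prod_(l < L) (if l \in val J then c l k else 1).

Definition tensor_word u : A := \prod_(x <- u) tensor_letter x.1 x.2.

Definition coordinate (l : 'I_L) u : seq nat :=
  [seq x.2 | x <- u & l \in (val x.1 : {set 'I_L})].

Definition tensor_moment u : R[i] := state (tensor_word u).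

Local Notation moment l := (centered_moment (a l) lam%:C).

Lemma coordinate_cat l u v : coordinate l (u ++ v) = coordinate l u ++ coordinate l v.
Proof. by rewrite /coordinate filter_cat map_cat. Qed.

Lemma coordinate_cons l J k u :
  coordinate l ((J, k) :: u) = if l \in val J then k :: coordinate l u else coordinate l u.
Proof. by rewrite /coordinate /=; case: ifP. Qed.

Lemma coordinate_sub l u k : k \notin labels u -> k \notin coordinate l u.
Proof.
apply: contra => /mapP[x]; rewrite mem_filter => /andP[_ xu] ->.
exact: map_f.
Qed.

Lemma alg_letter l k : alg l (c l k).
Proof.
apply: subalgebraB => //; apply: subalgebraZ => //; exact: subalgebra1.
Qed.

Lemma alg_letters l ks : alg l (\prod_(k <- ks) c l k).
Proof.
elim: ks => [|k ks ih]; first by rewrite big_nil; exact: subalgebra1.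
by rewrite big_cons; apply: subalgebraM => //; exact: alg_letter.
Qed.

Lemma tensor_word_coordinate u :
  tensor_word u = \prod_(l < L) \prod_(k <- coordinate l u) c l k.
Proof.
elim: u => [|[J k] u ih].
  by rewrite /tensor_word big_nil big1 // => l _; rewrite big_nil.
rewrite /tensor_word big_cons -/(tensor_word u) ih /= prod_mul_comm.
- apply: eq_bigr => l _; rewrite coordinate_cons.
  by case: ifP => _; rewrite ?mul1r // big_cons.
- exact: index_enum_uniq.
- move=> i j ij; case: ifP => _; last by rewrite mul1r mulr1.
  exact: (alg_independent.1 i j ij _ _ (alg_letter _ _) (alg_letters _ _)).
Qed.

Lemma tensor_moment_coordinate u :
  tensor_moment u = \prod_(l < L) moment l (coordinate l u).
Proof.
rewrite /tensor_moment tensor_word_coordinate.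
by rewrite alg_independent.2 // => l; exact: alg_letters.
Qed.

Lemma tensor_moment_nil : tensor_moment [::] = 1.
Proof. by rewrite /tensor_moment /tensor_word big_nil state1. Qed.

Lemma tensor_moment_eq0 l u : moment l (coordinate l u) = 0 -> tensor_moment u = 0.
Proof.
by move=> h; rewrite tensor_moment_coordinate (bigD1 l) //= h mul0r.
Qed.

Lemma tensor_moment_relabel f u : injective f ->
  tensor_moment (relabel f u) = tensor_moment u.
Proof.
move=> finj; rewrite !tensor_moment_coordinate; apply: eq_bigr => l _.
rewrite -[RHS](centered_moment_relabel _ (@a_free l) _ (@a_identical l) finj).
congr centered_moment; rewrite /coordinate /relabel filter_map -!map_comp.
by [].
Qed.

(** A label carried by a single letter [J] occurs once in any coordinate [l] of [J], and such an [l]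
    exists because [J] is nonempty. *)
Lemma tensor_moment_open u : open_labels u != [::] -> tensor_moment u = 0.
Proof.
case E: (open_labels u) => [//|k s] _.
have : k \in open_labels u by rewrite E inE eqxx.
rewrite mem_open_labels => {E s} /eqP k1.
have ku : k \in labels u by rewrite -has_pred1 has_count k1.
case/mapP: ku k1 => -[J k'] /= xu ->; case/splitPr: xu => u1 u2.
rewrite /labels map_cat count_cat /= eqxx addnCA => /eqP.
rewrite add1n eqSS addn_eq0 => /andP[/eqP h1 /eqP h2].
have k1 : k' \notin labels u1 by apply/count_memPn.
have k2 : k' \notin labels u2 by apply/count_memPn.
have /set0Pn[l lJ] := valP J.
apply: (@tensor_moment_eq0 l); rewrite coordinate_cat coordinate_cons lJ.
by apply: (centered_moment_single (@a_free l) (@a_mean l)) => //; exact: coordinate_sub.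
Qed.

(** No coordinate sees both letters when their sets are disjoint, so the coordinate words agree in
    either order. *)
Lemma tensor_letter_comm J K i k : hL_edge J K ->
  tensor_word [:: (J, i); (K, k)] = tensor_word [:: (K, k); (J, i)].
Proof.
move=> /eqP JK; rewrite !tensor_word_coordinate; apply: eq_bigr => l _.
rewrite !coordinate_cons; case: ifP => lJ; case: ifP => lK //.
have : l \in finset.setI (val J) (val K) by rewrite inE lJ lK.
by rewrite JK inE.
Qed.

Lemma tensor_word_cat u v : tensor_word (u ++ v) = tensor_word u * tensor_word v.
Proof. by rewrite /tensor_word big_cat. Qed.

Lemma tensor_word_lpush J k m :
  tensor_word (lpush (hL L) J k m) = tensor_word ((J, k) :: m).
Proof.
elim: m => // -[K i] m ih /=; case: ifP => // JK.
rewrite -[in LHS]cat1s tensor_word_cat ih -tensor_word_cat.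
transitivity (tensor_word ([:: (J, k); (K, i)] ++ m)); last by [].
by rewrite [RHS]tensor_word_cat (tensor_letter_comm k i JK) -tensor_word_cat.
Qed.

Lemma tensor_moment_lpush v J k m :
  tensor_moment (v ++ (J, k) :: m) = tensor_moment (v ++ lpush (hL L) J k m).
Proof.
by rewrite /tensor_moment 2!tensor_word_cat tensor_word_lpush.
Qed.

Lemma coordinate_disjoint l J m : all (fun x => edge (hL L) J x.1) m ->
  l \in val J -> coordinate l m = [::].
Proof.
move=> mJ lJ; rewrite /coordinate; case E: [seq _ <- _ | _] => [|x s] //.
have : x \in [seq x <- m | l \in (val x.1 : {set 'I_L})] by rewrite E inE eqxx.
rewrite mem_filter => /andP[lx xm].
have /eqP JK : hL_edge J x.1 by apply: (allP mJ).
have : l \in finset.setI (val J) (val x.1) by rewrite inE lJ lx.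
by rewrite JK inE.
Qed.

(** If the letters in between are disjoint from [J], the two copies of [o] are adjacent in each
    coordinate of [J] and give a factor [sigma ^+ 2] there; when [lpop] fails, some coordinate has
    zero moment. *)
Lemma tensor_moment_lpop v J o m : uniq (labels m) -> o \in labels m ->
  o \notin labels v ->
  tensor_moment (v ++ (J, o) :: m) =
    if lpop (hL L) J o m is Some r
    then (sigma ^+ #|val J|)%:C ^+ 2 * tensor_moment (v ++ r) else 0.
Proof.
move=> um om ov; case E: lpop => [r|].
  have [m1 [m2 [em -> hm1]]] := lpop_Some E.
  move: um; rewrite em /labels map_cat /= cat_uniq /= negb_or.
  case/and3P=> _ /andP[om1 _] /andP[om2 _].
  rewrite !tensor_moment_coordinate.
  have -> : (sigma ^+ #|val J|)%:C ^+ 2 =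
      \prod_(l < L) (if l \in val J then (sigma ^+ 2)%:C else 1).
    by rewrite -big_mkcond /= prodr_const -!rmorphXn /= exprAC.
  rewrite -big_split /=; apply: eq_bigr => l _.
  rewrite !coordinate_cat coordinate_cons coordinate_cat coordinate_cons.
  case lJ: (l \in val J); last by rewrite mul1r.
  rewrite (coordinate_disjoint hm1 lJ) /=.
  apply: (centered_moment_pair (@a_free l) (@a_mean l) (@a_variance l)) => //;
    exact: coordinate_sub.
case/mapP: om E um ov => -[K o'] /= xm ->; case/splitPr: xm => m1 m2 E um ov.
move: um; rewrite /labels map_cat /= cat_uniq /= negb_or.
case/and3P=> um1 /andP[om1 _] /andP[om2 _].
have notin l w : o' \notin labels w -> o' \notin coordinate l w.
  exact: coordinate_sub.
(* If the partner carries a different set, a coordinate in exactly one of the two sees the label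
   once. *)
have [KJ|KJ] := eqVneq K J; last first.
  have [l lJK] : exists l, (l \in val J) != (l \in val K).
    apply/existsP; apply: contraNT KJ; rewrite negb_exists => /forallP h.
    apply/eqP/val_inj/setP => l; apply/esym/eqP.
    by have := h l; rewrite negbK.
  apply: (@tensor_moment_eq0 l).
  rewrite !coordinate_cat coordinate_cons coordinate_cat coordinate_cons.
  case lJ: (l \in val J) lJK; case lK: (l \in val K) => // _.
    apply: (centered_moment_single (@a_free l) (@a_mean l)) => //; first exact: notin.
    by rewrite mem_cat negb_or !notin.
  rewrite catA; apply: (centered_moment_single (@a_free l) (@a_mean l)) => //; last exact: notin.
  by rewrite mem_cat negb_or !notin.
rewrite KJ in E *.
(* The partner carries [J] but is blocked by some [X] meeting [J]; in a common coordinate the pair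
   encloses another label. *)
have /allPn[[X i] xm1 JX] : ~~ all (fun x => edge (hL L) J x.1) m1.
  by apply/negP => h; rewrite lpop_cat in E.
have /set0Pn[l] := JX; rewrite inE => /andP[lJ lX].
apply: (@tensor_moment_eq0 l).
rewrite !coordinate_cat coordinate_cons coordinate_cat coordinate_cons lJ.
apply: (centered_moment_cross (@a_free l) (@a_mean l)) => //; try exact: notin.
- rewrite /coordinate; apply: subseq_uniq um1; apply: map_subseq.
  exact: filter_subseq.
- apply/eqP => e; have : i \in coordinate l m1.
    by apply/mapP; exists (X, i) => //; rewrite mem_filter lX.
  by rewrite e.
Qed.

(** Each factor is a centered variable plus [lam]; the terms of the product are sorted by the set
    [J] of centered positions. *)
Lemma tensor_expansion k :
  \prod_(l < L) a l k - ((lam ^+ L)%:C)%:A =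
  \sum_(J : Pstar L) (lam ^+ #|finset.setC (val J)|)%:C *: tensor_letter J k.
Proof.
pose T (J : {set 'I_L}) : A := (lam ^+ #|finset.setC J|)%:C *:
  \prod_(l < L) (if l \in J then c l k else 1).
have TE (J : {set 'I_L}) :
    \prod_(l < L) (if l \in J then c l k else (lam%:C)%:A) = T J.
  rewrite /T; have -> : (lam ^+ #|finset.setC J|)%:C =
      \prod_(l < L) (if l \in J then 1 else lam%:C).
    rewrite (eq_bigr (fun l => if l \in finset.setC J then lam%:C else 1)).
      by rewrite -big_mkcond prodr_const rmorphXn.
    by move=> l _; rewrite inE; case: ifP.
  elim: (index_enum _) => [|l r ih]; first by rewrite !big_nil scale1r.
  rewrite !big_cons ih; case: ifP => _.
    by rewrite mul1r scalerAr.
  by rewrite mul1r -scalerAl mul1r scalerA.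
have -> : \prod_(l < L) a l k = \sum_(J : {set 'I_L}) T J.
  under [RHS]eq_bigr do rewrite -TE.
  rewrite -[RHS]bigA_distr; apply: eq_bigr => l _.
  by rewrite /= /centering subrK.
(* The empty set yields [lam ^+ L], which the subtraction removes. *)
rewrite (bigD1 finset.set0) //= {1}/T finset.setC0 cardsT card_ord big1 => [|l _].
  rewrite addrAC subrr add0r.
  exact: (big_sub [pred J : {set 'I_L} | J != finset.set0] T).
by rewrite inE.
Qed.

Lemma partial_momentE n p u :
  partial_moment (fun J : Pstar L => (lam ^+ #|finset.setC (val J)|)%:C)
    tensor_moment n p u =
  state ((\sum_(k < n) (\prod_(l < L) a l k - ((lam ^+ L)%:C)%:A)) ^+ p *
    tensor_word u).
Proof.
elim: p u => [|p ih] u /=; first by rewrite expr0 mul1r.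
set S := \sum_(k < n) _.
have -> : S ^+ p.+1 * tensor_word u =
    \sum_(J : Pstar L) (lam ^+ #|finset.setC (val J)|)%:C *:
      \sum_(k < n) (S ^+ p * tensor_word ((J, val k) :: u)).
  rewrite exprSr -mulrA {2}/S.
  under eq_bigr do rewrite tensor_expansion.
  rewrite exchange_big mulr_suml mulr_sumr; apply: eq_bigr => J _.
  rewrite -scaler_sumr -scalerAl -[LHS]scalerAr mulr_suml mulr_sumr.
  by congr (_ *: _); apply: eq_bigr => k _; rewrite /tensor_word big_cons.
rewrite raddf_sum; apply: eq_bigr => J _ /=.
rewrite scalarZ raddf_sum; congr (_ * _).
by apply: eq_bigr => k _; exact: ih.
Qed.

End TensorModel.

(** * Convergence of the moments of the normalized tensor sum *)

Theorem corollary1p5 (R : realType) (A : ncprob R) (L : nat) (hL1 : (1 <= L)%N)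
    (lam sigma : R)
    (alg : 'I_L -> set A) (a : 'I_L -> nat -> A)
    (alg_subalgebra : forall l, subalgebra (alg l))
    (alg_independent : classically_independent alg)
    (a_in_alg : forall l k, alg l (a l k))
    (a_selfadjoint : forall l k, selfadjoint (a l k))
    (a_free : forall l, freely_independent (fun k => generated (a l k)))
    (a_identical : forall l, identically_distributed (a l))
    (a_mean : forall l k, nc_mean (a l k) = lam%:C)
    (a_variance : forall l k, nc_variance (a l k) = (sigma ^+ 2)%:C)
    (B : ncprob R) (s : Pstar L -> B)
    (s_semicircular : forall J, semicircular (s J))
    (s_independent : g_independent (hL L) (fun J => generated (s J))) :
  cvg_in_distribution (tensor_sum lam a)
    (\sum_(J : Pstar L)
       (lam ^+ #|finset.setC (val J)| * sigma ^+ #|val J|)%:C *: s J).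
Proof.
move=> p.
(* The coefficient of [s J] splits into a power of [lam] from the expansion and a power of [sigma],
   contributed by each of the two letters of a pair. *)
pose coef (J : Pstar L) : R[i] := (lam ^+ #|finset.setC (val J)|)%:C.
pose wt (J : Pstar L) : R[i] := (sigma ^+ #|val J|)%:C.
pose G := tensor_moment lam a.
have G_relabel f u : injective f -> G (relabel f u) = G u.
  exact: (tensor_moment_relabel _ alg_subalgebra alg_independent).
have G_open u : open_labels u != [::] -> G u = 0.
  exact: (tensor_moment_open alg_subalgebra alg_independent a_in_alg a_free a_mean).
have G_lpush v J k m : G (v ++ (J, k) :: m) = G (v ++ lpush (hL L) J k m).
  exact: (tensor_moment_lpush _ alg_subalgebra alg_independent).
have G_lpop v J o m : uniq (labels m) -> o \in labels m -> o \notin labels v ->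
    G (v ++ (J, o) :: m) =
    if lpop (hL L) J o m is Some r then wt J ^+ 2 * G (v ++ r) else 0.
  exact: (tensor_moment_lpop alg_subalgebra alg_independent a_in_alg a_free
    a_mean a_variance).
have G1 (v : seq (Pstar L * nat)) :
    avoids v (closed_labels ([::] : seq (Pstar L * nat))) ->
    G (v ++ [::]) = 1 * G (v ++ [::]).
  by rewrite mul1r.
(* The process starts from the empty word, hence from the empty stack with [c = 1]. *)
have lim := @limit_moment_wick _ _ _ _ _ s_semicircular s_independent coef wt G
  (tensor_moment_nil lam a) G_open G_lpush G_lpop p [::] [::] 1 isT isT isT G1.
have cvgS := @cvg_partial_moment _ _ coef G G_relabel G_open p [::].
rewrite lim big_nil mulr1 mul1r mulr1 in cvgS.
have -> : \sum_(J : Pstar L)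
      (lam ^+ #|finset.setC (val J)| * sigma ^+ #|val J|)%:C *: s J =
    \sum_J (coef J * wt J) *: s J.
  by apply: eq_bigr => J _; rewrite rmorphM.
apply: (@eventually_cvg _ _ _ _ 0 _ cvgS) => n _.
(* The empty word has no open label, so only the normalization [rsqrt n ^+ p] remains. *)
rewrite [size _]/= expr0 mulr1 partial_momentE [tensor_word _ _ _]/tensor_word.
by rewrite big_nil mulr1 /tensor_sum exprZn scalarZ.
Qed.
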